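(* Let $A_1=(x_1,y_1)$, $A_2=(x_2,y_2)$, $B_1=(u_1,v_1)$ and $B_2=(u_2,v_2)$ be points in $\mathbb Z^2$ such that $A_1\prec A_2$ and $B_1\prec B_2$. Suppose additionally that $x_1+y_1=x_2+y_2$. Then, for all $m\ge0$, $$H^{\ge 2m+1}_{A_1\to B_2,A_2\to B_1}(t,q)=H^{\ge 2m}_{A_1\to B_2,A_2\to B_1}(t,q)=f_{2m,A_1,A_2,B_2,B_1}(t,q),$$ $$H^{\ge 2m+2}_{A_1\to B_1,A_2\to B_2}(t,q)=H^{\ge 2m+1}_{A_1\to B_1,A_2\to B_2}(t,q)=f_{2m+1,A_1,A_2,B_2,B_1}(t,q).$$ Let now $A=(x,y)$ and $B=(u,v)$ be points in $\mathbb Z^2$. Then, for all $r\ge0$, $$H^{\ge r}_{A\to B_1,A\to B_2}(t,q)=f_{r,A,A,B_2,B_1}(t,q),$$ $$H^{\ge r}_{A_1\to B,A_2\to B}(t,q)=f_{r,A_1,A_2,B,B}(t,q),$$ $$H^{\ge r}_{A\to B,A\to B}(t,q)=\begin{cases}f_{0,A,A,B,B}(t,q) & \text{if }r=0,\\[2pt] 2\sum_{j\ge1}(-1)^{j-1}f_{r+j,A,A,B,B}(t,q) & \text{if }r\ge1.\end{cases}$$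
   Context: For points of $\mathbb Z^2$, $(x_1,y_1)\prec(x_2,y_2)$ means $x_1<x_2$ and $y_1>y_2$ (the first point is strictly northwest of the second). For integers $M,N$, the $q$-binomial coefficient $\begin{bmatrix}M\\ N\end{bmatrix}_q$ equals $\frac{(1-q^M)(1-q^{M-1})\cdots(1-q^{M-N+1})}{(1-q^N)(1-q^{N-1})\cdots(1-q)}$ if $0\le N\le M$, and $0$ otherwise. $\mathcal P_{A\to B}$ is the set of lattice paths from $A$ to $B$ with steps $N=(0,1)$ and $E=(1,0)$. The vertices of a path are numbered $0,1,2,\dots$ along the path starting with $0$ at the initial point. A descent (valley) is a vertex preceded by an $E$ and followed by an $N$; $\mathrm{des}(P)$ is the number of descents and $\mathrm{maj}(P)$ is the sum of the positions (vertex numbers) of the descents. Crossings of two paths $P,Q$: suppose $V_1,\dots,V_s$ ($s\ge1$) is a maximal sequence of consecutive common vertices of $P$ and $Q$ such that neither $V_1$ nor $V_s$ is an endpoint of $P$ or $Q$, and for each of $P$ and $Q$, its step arriving at $V_1$ is of the same type ($N$ or $E$) as its step leaving $V_s$. Then $V_s$ is called a crossing of $P$ and $Q$. $\chi(P,Q)$ denotes the number of crossings of $P$ and $Q$. For points $C_1,C_2,D_1,D_2\in\mathbb Z^2$ and $r\ge0$, $$H^{\ge r}_{C_1\to D_1,C_2\to D_2}(t,q)=\sum_{(P,Q)} t^{\mathrm{des}(P)+\mathrm{des}(Q)}q^{\mathrm{maj}(P)+\mathrm{maj}(Q)},$$ where the sum is over all pairs $(P,Q)$ with $P\in\mathcal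 P_{C_1\to D_1}$, $Q\in\mathcal P_{C_2\to D_2}$ and $\chi(P,Q)\ge r$. For $k\in\mathbb Z$ and points $A_1=(x_1,y_1)$, $A_2=(x_2,y_2)$, $B_1=(u_1,v_1)$, $B_2=(u_2,v_2)$ (possibly coinciding), with arguments in this order, $$f_{k,A_1,A_2,B_2,B_1}(t,q)=q^{k(k+x_2-x_1)}\left(\sum_{n\ge0} t^n q^{n(n+k)} \begin{bmatrix}u_2-x_1\\ n\end{bmatrix}_q \begin{bmatrix}v_2-y_1\\ n+k\end{bmatrix}_q\right)\left(\sum_{n\ge0} t^n q^{n(n-k)} \begin{bmatrix}u_1-x_2\\ n\end{bmatrix}_q \begin{bmatrix}v_1-y_2\\ n-k\end{bmatrix}_q\right).$$ *)

(* Defs.v *)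
From mathcomp Require Export all_boot all_order all_algebra.
From mathcomp Require Export boolp classical_sets cardinality fsbigop.

Set Implicit Arguments.
Unset Strict Implicit.
Unset Printing Implicit Defensive.

Import Order.TTheory GRing.Theory Num.Theory.

Local Open Scope classical_set_scope.
Local Open Scope ring_scope.

Notation point := (int * int)%type.

Definition northwest (A B : point) : bool := (A.1 < B.1) && (B.2 < A.2).

(* Both sides of the identities live in Q(q)[t]: the coefficient field is the
   fraction field of Z[q], because q-binomials are quotients and f_k involves a
   possibly negative power of q.  In {poly Qq}, the variable 'X is t. *)
Definition Qq : fieldType := {fraction {poly int}}.
Definition q : Qq := tofrac ('X : {poly int}).

Definition step : Type := bool.
Definition stepN : step := false.
Definition stepE : step := true.

(* A lattice path is its initial point together with its sequence of steps. *)
Definition lpath : Type := (point * seq step)%type.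
Definition steps (P : lpath) : seq step := P.2.
Definition len (P : lpath) : nat := size (steps P).

(* stepat P i leads from vertex P i to vertex P i.+1 (for i < len P). *)
Definition stepat (P : lpath) (i : nat) : step := nth stepN (steps P) i.

Definition vertex (P : lpath) (i : nat) : point :=
  (P.1.1 + (count_mem stepE (take i (steps P)))%:Z,
   P.1.2 + (count_mem stepN (take i (steps P)))%:Z).

Definition paths (A B : point) : set lpath :=
  [set P | vertex P 0 = A /\ vertex P (len P) = B].

Definition is_descent (P : lpath) (i : nat) : bool :=
  [&& (0 < i)%N, (i < len P)%N,
      stepat P i.-1 == stepE & stepat P i == stepN].

Definition des (P : lpath) : nat := (\sum_(i < len P | is_descent P i) 1)%N.
Definition maj (P : lpath) : nat := (\sum_(i < len P | is_descent P i) i)%N.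

(* The common vertices V_1, ..., V_(s+1) are vertex P i, ..., vertex P (i + s)
   and also vertex Q j, ..., vertex Q (j + s); the first four conditions say
   that V_1 and V_(s+1) are not endpoints, the next three that the sequence is
   common and maximal, and the last two compare arriving and leaving steps. *)
Definition crossing_run (P Q : lpath) (i j s : nat) : bool :=
  [&& (0 < i)%N, (0 < j)%N, (i + s < len P)%N, (j + s < len Q)%N,
      [forall l : 'I_s.+1, vertex P (i + l) == vertex Q (j + l)],
      vertex P i.-1 != vertex Q j.-1,
      vertex P (i + s).+1 != vertex Q (j + s).+1,
      stepat P i.-1 == stepat P (i + s)
    & stepat Q j.-1 == stepat Q (j + s)].

(* vertex P e is a crossing, i.e. the last vertex of a crossing run. *)
Definition is_crossing (P Q : lpath) (e : nat) : bool :=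
  [exists i : 'I_(len P), exists j : 'I_(len Q), exists s : 'I_(len P),
    (i + s == e)%N && crossing_run P Q i j s].

(* The vertices of a path are distinct, so counting their positions is counting
   the crossings. *)
Definition crossings (P Q : lpath) : nat :=
  #|[set e : 'I_(len P) | is_crossing P Q e]%SET|.

Definition Hge (r : nat) (C1 D1 C2 D2 : point) : {poly Qq} :=
  \sum_(PQ \in [set PQ : lpath * lpath |
      [/\ paths C1 D1 PQ.1, paths C2 D2 PQ.2
        & (r <= crossings PQ.1 PQ.2)%N]])
    q ^+ (maj PQ.1 + maj PQ.2) *: 'X ^+ (des PQ.1 + des PQ.2).

Definition qbinom (M N : int) : Qq :=
  if (0 <= N) && (N <= M) then
    (\prod_(i < `|N|%N) (1 - q ^ (M - i%:Z)))
      / (\prod_(i < `|N|%N) (1 - q ^ (N - i%:Z)))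
  else 0.

(* The argument order is A1, A2, B2, B1. *)
Definition f (k : int) (A1 A2 B2 B1 : point) : {poly Qq} :=
  let: (x1, y1) := A1 in let: (x2, y2) := A2 in
  let: (u1, v1) := B1 in let: (u2, v2) := B2 in
  q ^ (k * (k + x2 - x1)) *:
  ((\sum_(n \in [set: nat])
      (q ^ (n%:Z * (n%:Z + k)) * qbinom (u2 - x1) n%:Z
         * qbinom (v2 - y1) (n%:Z + k)) *: 'X ^+ n)
   * (\sum_(n \in [set: nat])
      (q ^ (n%:Z * (n%:Z - k)) * qbinom (u1 - x2) n%:Z
         * qbinom (v1 - y2) (n%:Z - k)) *: 'X ^+ n)).

(* \sum_(i \in A) is 0 by convention when infinitely many terms are nonzero; the
   following lemmas show that this never happens for the sums used here. *)
Lemma qbinom_eq0 (M N : int) : M < N -> qbinom M N = 0.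
Proof. by move=> ltMN; rewrite /qbinom (leNgt N M) ltMN andbF. Qed.

Lemma finite_paths (A B : point) : finite_set (paths A B).
Proof.
pose n := (`|B.1 - A.1| + `|B.2 - A.2|)%N.
apply: (@sub_finite_set _ _
  [set` [seq (A, tval w) | w : n.-tuple bool]]); last first.
  exact: finite_seq.
move=> [[x y] w] [PA PB] /=.
have -> : A = (x, y) by rewrite -PA /vertex /= take0 /= !addr0.
have szw : size w == n.
  move: PA PB; rewrite /vertex /len /= take0 take_size !addr0 => EA EB.
  rewrite /n -EA -EB /= ![_ + _%:Z]addrC !addrK !absz_nat.
  rewrite -(count_predC (pred1 stepE)) eqn_add2l; apply/eqP.
  by apply: eq_count => -[].
by apply/mapP; exists (Tuple szw) => //; rewrite mem_enum.
Qed.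

Lemma finite_path_pairs (r : nat) (C1 D1 C2 D2 : point) :
  finite_set [set PQ : lpath * lpath |
    [/\ paths C1 D1 PQ.1, paths C2 D2 PQ.2
      & (r <= crossings PQ.1 PQ.2)%N]].
Proof.
apply: (@sub_finite_set _ _ (paths C1 D1 `*` paths C2 D2)).
  by move=> PQ [].
by apply: finite_setX; exact: finite_paths.
Qed.

Lemma finite_support_f (M N k : int) :
  finite_set [set n : nat |
    (q ^ (n%:Z * (n%:Z + k)) * qbinom M n%:Z * qbinom N (n%:Z + k))
      *: ('X ^+ n : {poly Qq}) != 0].
Proof.
apply: (@sub_finite_set _ _ `I_(`|M|%N.+1)); last exact: finite_II.
move=> n /=; apply: contraNltn => ltMn; apply/eqP.
rewrite (@qbinom_eq0 M) ?mulr0 ?mul0r ?scale0r //.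
by apply: le_lt_trans (ler_norm M) _; rewrite -abszE ltz_nat.
Qed.

Lemma f_eq0 (k : int) (A1 A2 B2 B1 : point) :
  B2.2 - A1.2 < k -> f k A1 A2 B2 B1 = 0.
Proof.
case: A1 A2 B2 B1 => [x1 y1] [x2 y2] [u2 v2] [u1 v1] /= ltk.
rewrite /f fsbig1 ?mul0r ?scaler0 // => n _.
rewrite (@qbinom_eq0 (v2 - y1)) ?mulr0 ?scale0r //.
by apply: lt_le_trans ltk _; rewrite lerDr.
Qed.

(* Main.v *)
Require Import Defs.
From mathcomp Require Import zify ring.
Import Order.TTheory GRing.Theory Num.Theory.
Local Open Scope classical_set_scope.
Local Open Scope ring_scope.

(* The starting points lie on one antidiagonal, so after i steps the paths P
   and Q differ by a horizontal gap, and crossings are sign changes of the gap.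
   Let c(P, Q) be the number of sign changes when the gap counts as positive
   at the start, so that the parity of c is the sign of the last nonzero gap.

   Let X_r(U, V) be the generating function of pairs P : A1 -> U, Q : A2 -> V
   with c >= r, where U is weakly northwest of V if r is odd and weakly
   southeast of V if r is even.  Appending a gap of the sign prescribed by the
   parity of r, or a zero gap, does not change the truth of c >= r; hence the
   last step of either path can be removed, which gives for each endpoint the
   recurrence
     X(U) = X(U-E) + X(U-N) - (1 - t q^(n-1)) X(U-E-N),   n the length,
   as long as the endpoints stay in order.  When U = V = B one splits according
   to both last steps.  The only case that the order does not allow to reduce
   is the one where the last steps cross at B; there the parity of c shows that
   c >= r and c >= r-1 are equivalent, so the level drops from r to r-1.

   The products f_r satisfy the same recurrences, by the q-Pascal rule applied
   to the sums g_k(u, v) = sum_n t^n q^(n(n+k)) [u, n] [v, n+k]; the drop from r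
   to r-1 is the identity g_k(u, v) - g_k(u-1, v) = t q^(u+k) g_(k+1)(u-1, v).

   If A1 = A2 and P <> Q, the crossing number chi satisfies
   {c(P, Q), c(Q, P)} = {chi, chi + 1}; for equal endpoints this gives
   H_r + H_(r+1) = 2 f_(r+1), which telescopes to the alternating sum. *)

Set Implicit Arguments.
Unset Strict Implicit.
Unset Printing Implicit Defensive.

(** * q-binomial coefficients and two-rowed arrays *)

Lemma q_neq0 : q != 0.
Proof. by rewrite /q tofrac_eq0 polyX_eq0. Qed.

Lemma qexp_neq1 (n : nat) : q ^+ n.+1 != 1.
Proof.
rewrite /q -tofracXn -tofrac1 tofrac_eq; apply/eqP => /(congr1 (fun p => p.[0])).
by rewrite hornerXn hornerC expr0n /= => /eqP; rewrite eq_sym oner_eq0.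
Qed.

Lemma qexpD (a b : int) : q ^ (a + b) = q ^ a * q ^ b.
Proof. by rewrite expfzDr ?q_neq0. Qed.

Lemma qbinom_lt0 (M N : int) : N < 0 -> qbinom M N = 0.
Proof. by move=> N0; rewrite /qbinom leNgt N0. Qed.

Lemma qbinom_neg (M N : int) : M < 0 -> qbinom M N = 0.
Proof.
by move=> M0; rewrite /qbinom; case: ifP => // /andP[N0 /(le_trans N0)]; rewrite leNgt M0.
Qed.

Lemma qbinom0 (M : int) : 0 <= M -> qbinom M 0 = 1.
Proof. by move=> M0; rewrite /qbinom lexx M0 /= !big_ord0 divr1. Qed.

Lemma qbinom_denom_neq0 (n : nat) :
  \prod_(i < n) (1 - q ^ (n%:Z - i%:Z)) != 0 :> Qq.
Proof.
apply/prodf_neq0 => i _; rewrite subr_eq0 eq_sym.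
have -> : n%:Z - i%:Z = (n - i.+1).+1%:Z by have := ltn_ord i; lia.
exact: qexp_neq1.
Qed.

(** Algebra of the q-Pascal rule, with [x] = q^(M - N) and [y] = q^N, so that [x * y] = q^M; [P / D]
    is the q-binomial of M - 1 over N - 1. *)
Lemma frac_identity (K : fieldType) (x y P D : K) : D != 0 -> 1 - y != 0 ->
  (1 - x * y) * P / ((1 - y) * D) - P * (1 - x) / ((1 - y) * D) = x * (P / D).
Proof. by move=> D0 y1; field; rewrite D0 y1. Qed.

(** At M = N = 0 the left side would be 1 and the right side 0, since a negative top entry gives 0.
    The side conditions of [array_gf_subl] and [array_gf_subr] trace back to this corner. *)
Lemma qbinom_pascal (M N : int) : (M != 0) || (N != 0) ->
  qbinom M N - qbinom (M - 1) N = q ^ (M - N) * qbinom (M - 1) (N - 1).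
Proof.
move=> MN; case: (ltrP N 0) => [N0|].
  by rewrite !qbinom_lt0 ?subrr ?mulr0//; lia.
case: N MN => // -[|n] MN _.
  rewrite [in RHS]qbinom_lt0// mulr0.
  case: (ltrP M 0) => M0; first by rewrite !qbinom_neg ?subrr//; lia.
  by rewrite !qbinom0 ?subrr//; lia.
case: (ltrP M n.+1%:Z) => nM.
  by rewrite !qbinom_eq0 ?subrr ?mulr0//; lia.
case: M nM {MN} => // m; rewrite lez_nat => nm.
have -> : n.+1%:Z - 1 = n%:Z by lia.
have num1 : \prod_(i < n.+1) (1 - q ^ (m%:Z - i%:Z)) =
    (1 - q ^+ m) * \prod_(i < n) (1 - q ^ (m%:Z - 1 - i%:Z)) :> Qq.
  rewrite big_ord_recl subr0; congr (_ * _); apply: eq_bigr => i _.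
  by congr (1 - q ^ _); rewrite /= /bump /=; lia.
have den1 : \prod_(i < n.+1) (1 - q ^ (n.+1%:Z - i%:Z)) =
    (1 - q ^+ n.+1) * \prod_(i < n) (1 - q ^ (n%:Z - i%:Z)) :> Qq.
  rewrite big_ord_recl subr0; congr (_ * _); apply: eq_bigr => i _.
  by congr (1 - q ^ _); rewrite /= /bump /=; lia.
have num2 : \prod_(i < n.+1) (1 - q ^ (m%:Z - 1 - i%:Z)) =
    (\prod_(i < n) (1 - q ^ (m%:Z - 1 - i%:Z))) * (1 - q ^ (m%:Z - n.+1%:Z)) :> Qq.
  by rewrite big_ord_recr /=; congr (_ * (1 - q ^ _)); lia.
have -> : qbinom (m%:Z - 1) n.+1%:Z =
    (\prod_(i < n.+1) (1 - q ^ (m%:Z - 1 - i%:Z)))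
      / (\prod_(i < n.+1) (1 - q ^ (n.+1%:Z - i%:Z))).
  (* When m = n + 1 the convention 0 agrees with the product, whose last factor is 1 - q^0. *)
  rewrite /qbinom; case: ifP => //= nm'.
  have -> : m%:Z - 1 = n%:Z by lia.
  by rewrite big_ord_recr /= subrr expr0z subrr mulr0 mul0r.
rewrite /qbinom ifT ?ifT/=; [|lia|lia].
rewrite num2 num1 den1.
have := qbinom_denom_neq0 n; set D := \prod_(_ < _) _ => D0.
set P := \prod_(_ < _) _.
have q1 : 1 - q ^+ n.+1 != 0 by rewrite subr_eq0 eq_sym qexp_neq1.
have -> : q ^+ m = q ^ (m%:Z - n.+1%:Z) * q ^+ n.+1.
  by rewrite -[q ^+ n.+1]/(q ^ n.+1%:Z) -[LHS]/(q ^ m%:Z) -qexpD subrK.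
by rewrite frac_identity.
Qed.

(* Up to a power of q, the generating function of two-rowed arrays with n
   increasing entries in [1, u] above n + k increasing entries in [0, v - 1]. *)
Definition array_gf (k u v : int) : {poly Qq} :=
  \sum_(n \in [set: nat])
    (q ^ (n%:Z * (n%:Z + k)) * qbinom u n%:Z * qbinom v (n%:Z + k)) *: 'X ^+ n.

Lemma coef_array_gf (k u v : int) (n : nat) :
  (array_gf k u v)`_n =
    q ^ (n%:Z * (n%:Z + k)) * qbinom u n%:Z * qbinom v (n%:Z + k).
Proof.
(* [N] exceeds [n] and every index at which the q-binomial in [u] is nonzero. *)
pose N := (`|u|%N + n).+1.
have -> : array_gf k u v = \sum_(n < N)
    (q ^ (n%:Z * (n%:Z + k)) * qbinom u n%:Z * qbinom v (n%:Z + k)) *: 'X ^+ n.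
  rewrite (fsbig_ord _ _ (fun n : nat =>
    (q ^ (n%:Z * (n%:Z + k)) * qbinom u n%:Z * qbinom v (n%:Z + k)) *: 'X ^+ n)).
  apply/esym/fsbig_widen => // i [_ /negP] /=; rewrite -leqNgt => Ni.
  by rewrite (@qbinom_eq0 u) ?mulr0 ?mul0r ?scale0r//; lia.
rewrite -(poly_def N (fun n =>
  q ^ (n%:Z * (n%:Z + k)) * qbinom u n%:Z * qbinom v (n%:Z + k))).
by rewrite coef_poly ltnS leq_addl.
Qed.

(** A nonzero term needs n <= u and 0 <= n + k <= v with n >= 0; each alternative excludes this. *)
Lemma array_gf_eq0 (k u v : int) :
  [|| u < 0, v < 0, u < - k | v < k] -> array_gf k u v = 0.
Proof.
move=> H; apply/polyP => n; rewrite coef_array_gf coef0.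
suff [->|->] : qbinom u n%:Z = 0 \/ qbinom v (n%:Z + k) = 0.
  - by rewrite mulr0 mul0r.
  - by rewrite mulr0.
case/or4P: H => H.
- by left; rewrite qbinom_neg.
- by right; rewrite qbinom_neg.
- have [un|nu] := ltrP u n%:Z; first by left; rewrite qbinom_eq0.
  by right; rewrite qbinom_lt0//; lia.
- by right; rewrite qbinom_eq0//; lia.
Qed.

(** q-Pascal on the entry [u], coefficientwise. Lowering n to n - 1 produces the factor 'X and
    rewrites n + k as (n - 1) + (k + 1). At u = n = 0 the rule fails, but for k < 0 the other
    q-binomial is 0. *)
Lemma array_gf_subl (k u v : int) : (u != 0) || (k < 0) ->
  array_gf k u v - array_gf k (u - 1) v =
    q ^ (u + k) *: ('X * array_gf (k + 1) (u - 1) v).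
Proof.
move=> uk; apply/polyP => n.
rewrite coefB coefZ coefXM !coef_array_gf -mulrBl -mulrBr.
case: n => [|n] /=.
  rewrite mulr0; have [u0|u0] := boolP (u != 0).
    by rewrite qbinom_pascal ?u0// (@qbinom_lt0 _ (_ - 1))// !mulr0 mul0r.
  by rewrite (@qbinom_lt0 v) ?mulr0//; move: uk; rewrite (negbTE u0) /=; lia.
rewrite qbinom_pascal ?orbT//.
have -> : n.+1%:Z - 1 = n%:Z by lia.
have -> : n%:Z + (k + 1) = n.+1%:Z + k by lia.
rewrite !mulrA -!qexpD; congr (q ^ _ * _ * _); lia.
Qed.

Lemma array_gf_subr (k u v : int) : (v != 0) || (0 < k) ->
  array_gf k u v - array_gf k u (v - 1) =
    q ^ (v - k) *: array_gf (k - 1) u (v - 1).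
Proof.
move=> vk; apply/polyP => n.
rewrite coefB coefZ !coef_array_gf -mulrBr qbinom_pascal; last first.
  by case/orP: vk => [->//|k0]; apply/orP; right; lia.
rewrite [in RHS]mulrA [in RHS]mulrA mulrA -qexpD addrA.
rewrite [_ * q ^ (v - _)]mulrAC -qexpD; congr (q ^ _ * _ * _); lia.
Qed.

(* The weight of a valley at position n. *)
Definition tq (n : int) : {poly Qq} := q ^ n *: 'X.

(* For k = 0 this is the removal of the last step of a path. *)
Lemma array_gf_rec (k u v : int) :
  ((u != 0) || (k < 0)) && ((v != 0) || (0 <= k))
  || ((u != 0) || (k <= 0)) && ((v != 0) || (0 < k)) ->
  array_gf k u v = array_gf k (u - 1) v + array_gf k u (v - 1)
    - (1 - tq (u + v - 1)) * array_gf k (u - 1) (v - 1).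
Proof.
move=> H; have E : array_gf k u v - array_gf k (u - 1) v
  - (array_gf k u (v - 1) - array_gf k (u - 1) (v - 1)) =
  tq (u + v - 1) * array_gf k (u - 1) (v - 1).
  (* The mixed difference may be taken in either order; each alternative of [H] makes both Pascal
     rules applicable in one of the orders. *)
  rewrite /tq -scalerAl; case/orP: H => /andP[Hu Hv].
    rewrite !array_gf_subl// -scalerBr -mulrBr array_gf_subr; last by lia.
    by rewrite addrK -scalerAr scalerA -qexpD; congr (q ^ _ *: _); lia.
  rewrite opprB addrACA -[_ + (_ - _)]/(_ + _) [X in X = _](_ : _ =
    (array_gf k u v - array_gf k u (v - 1))
    - (array_gf k (u - 1) v - array_gf k (u - 1) (v - 1))); last by ring.
  rewrite !array_gf_subr// -scalerBr array_gf_subl; last by lia.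
  by rewrite scalerA -qexpD subrK; congr (q ^ _ *: _); lia.
by rewrite mulrBl mul1r -E; ring.
Qed.

(** * Recurrences of the product formula *)

(* Coordinates are relative to A1, and A2 = A1 + (d, -d).  The endpoint of
   abscissa a on the antidiagonal at distance n is (a, n - a): the path from A1
   ends at (a, n1 - a), the path from A2 at (b, n2 - b). *)
Definition pair_gf (r : nat) (d n1 a n2 b : int) : {poly Qq} :=
  q ^ (r%:Z * (r%:Z + d)) *:
  (if odd r
   then array_gf r%:Z b (n2 - b) * array_gf (- r%:Z) (a - d) (n1 - (a - d))
   else array_gf r%:Z a (n1 - a) * array_gf (- r%:Z) (b - d) (n2 - (b - d))).

(* The path from A1 ends weakly northwest of the other one if r is odd, weakly
   southeast of it if r is even. *)
Definition end_order (r : nat) (n1 a n2 b : int) : bool :=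
  if odd r then (a <= b) && (n2 - b <= n1 - a)
  else (b <= a) && (n1 - a <= n2 - b).

(** Both factors need length at least r to be nonzero: index r requires u >= 0 and v >= r, index -r
    requires u >= r and v >= 0. *)
Lemma pair_gf_eq0 (r : nat) (d n1 a n2 b : int) : (0 < r)%N -> 0 <= d ->
  end_order r n1 a n2 b -> (n1 <= 0) || (n2 <= 0) ->
  pair_gf r d n1 a n2 b = 0.
Proof.
move=> r0 d0; rewrite /pair_gf /end_order; case: ifP => _ ord n0.
- have [bz|] := boolP [|| b < 0, n2 - b < 0, b < - r%:Z | n2 - b < r%:Z].
    by rewrite array_gf_eq0 ?mul0r ?scaler0.
  by move=> Hz; rewrite (@array_gf_eq0 (- r%:Z)) ?mulr0 ?scaler0//; lia.
- have [bz|] := boolP [|| a < 0, n1 - a < 0, a < - r%:Z | n1 - a < r%:Z].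
    by rewrite array_gf_eq0 ?mul0r ?scaler0.
  by move=> Hz; rewrite (@array_gf_eq0 (- r%:Z)) ?mulr0 ?scaler0//; lia.
Qed.

Lemma array_gf_diag_rec (k n a : int) :
  ((a != 0) || (k < 0)) && ((n + 1 - a != 0) || (0 <= k))
  || ((a != 0) || (k <= 0)) && ((n + 1 - a != 0) || (0 < k)) ->
  array_gf k a (n + 1 - a) = array_gf k (a - 1) (n - (a - 1))
    + array_gf k a (n - a) - (1 - tq n) * array_gf k (a - 1) (n - 1 - (a - 1)).
Proof.
move=> H; rewrite array_gf_rec//.
have -> : a + (n + 1 - a) - 1 = n by ring.
have -> : n + 1 - a - 1 = n - a by ring.
have -> : n - 1 - (a - 1) = n - a by ring.
by have -> : n - (a - 1) = n + 1 - a by ring.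
Qed.

(** Moving one endpoint changes a single factor of [pair_gf]. The alternative [p = 0] covers the
    places where the recurrence of that factor may fail because its side conditions do. *)
Lemma rec_mull (R : comPzRingType) (t p s1 s2 s3 s4 : R) :
  p = 0 \/ s1 = s2 + s3 - (1 - t) * s4 ->
  p * s1 = p * s2 + p * s3 - (1 - t) * (p * s4).
Proof. by case=> ->; ring. Qed.

Lemma rec_mulr (R : comPzRingType) (t p s1 s2 s3 s4 : R) :
  p = 0 \/ s1 = s2 + s3 - (1 - t) * s4 ->
  s1 * p = s2 * p + s3 * p - (1 - t) * (s4 * p).
Proof. by case=> ->; ring. Qed.

Lemma pair_gf_recl (r : nat) (d n1 a n2 b : int) : (0 < r)%N -> 0 <= d ->
  end_order r n1 a n2 b -> end_order r n1 (a - 1) n2 b ->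
  pair_gf r d (n1 + 1) a n2 b = pair_gf r d n1 (a - 1) n2 b
    + pair_gf r d n1 a n2 b - (1 - tq n1) * pair_gf r d (n1 - 1) (a - 1) n2 b.
Proof.
move=> r0 d0; rewrite /pair_gf /end_order -!scalerAr -scalerDr -scalerBr.
have -> : a - 1 - d = a - d - 1 by ring.
case: ifP => _ o1 o2; congr (_ *: _).
- apply: rec_mull.
  have [bz|nbz] := boolP [|| b < 0, n2 - b < 0, b < - r%:Z | n2 - b < r%:Z].
    by left; apply: array_gf_eq0.
  by right; apply: array_gf_diag_rec; lia.
- apply: rec_mulr.
  have [bz|nbz] := boolP
    [|| b - d < 0, n2 - (b - d) < 0, b - d < r%:Z | n2 - (b - d) < - r%:Z].
    by left; apply: array_gf_eq0; rewrite opprK.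
  by right; apply: array_gf_diag_rec; lia.
Qed.

Lemma pair_gf_recr (r : nat) (d n1 a n2 b : int) : (0 < r)%N -> 0 <= d ->
  end_order r n1 a n2 b -> end_order r n1 a n2 (b - 1) ->
  pair_gf r d n1 a (n2 + 1) b = pair_gf r d n1 a n2 (b - 1)
    + pair_gf r d n1 a n2 b - (1 - tq n2) * pair_gf r d n1 a (n2 - 1) (b - 1).
Proof.
move=> r0 d0; rewrite /pair_gf /end_order -!scalerAr -scalerDr -scalerBr.
have -> : b - 1 - d = b - d - 1 by ring.
case: ifP => _ o1 o2; congr (_ *: _).
- apply: rec_mulr.
  have [bz|nbz] := boolP
    [|| a - d < 0, n1 - (a - d) < 0, a - d < r%:Z | n1 - (a - d) < - r%:Z].
    by left; apply: array_gf_eq0; rewrite opprK.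
  by right; apply: array_gf_diag_rec; lia.
- apply: rec_mull.
  have [bz|nbz] := boolP [|| a < 0, n1 - a < 0, a < - r%:Z | n1 - a < r%:Z].
    by left; apply: array_gf_eq0.
  by right; apply: array_gf_diag_rec; lia.
Qed.

(** Product-side counterparts of [term_gf_last]: a last E is stripped, and a last N of the other
    path is obtained by subtracting the pairs in which both end with E. *)
Definition pair_gfEE r d n a := pair_gf r d (n - 1) (a - 1) (n - 1) (a - 1).
Definition pair_gfEN r d n a :=
  pair_gf r d (n - 1) (a - 1) n a - pair_gfEE r d n a.
Definition pair_gfNE r d n a :=
  pair_gf r d n a (n - 1) (a - 1) - pair_gfEE r d n a.

(** Expansion of the product of two one-path recurrences according to the two last steps. The two
    conclusions differ in which factor belongs to the path from A1, as [pair_gf] does with the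
    parity of r. *)
Lemma diag_rec_identity (R : comPzRingType) (c t p1 p2 p3 p4 s1 s2 s3 s4 : R)
    (e1 := c * (p1 * s1)) (e2 := c * (p2 * s2)) (e3 := c * (p3 * s3))
    (e4 := c * (p4 * s4)) (f1 := c * (p2 * s1)) (f2 := c * (p1 * s2))
    (f3 := c * (p4 * s3)) (f4 := c * (p3 * s4)) :
  [\/ p1 = p2 + p3 - (1 - t) * p4 /\ s1 = s2 + s3 - (1 - t) * s4,
      [/\ p1 = 0, p2 = 0, p3 = 0 & p4 = 0] |
      [/\ s1 = 0, s2 = 0, s3 = 0 & s4 = 0]] ->
  e1 = e2 + (f1 - e2) + (f2 - e2)
    + (e3 - e4 - (f3 - e4) - (f4 - e4)
       + t * (f3 - e4 + (f4 - e4)) + t ^+ 2 * e4)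
  /\ e1 = e2 + (f2 - e2) + (f1 - e2)
    + (e3 - e4 - (f4 - e4) - (f3 - e4)
       + t * (f4 - e4 + (f3 - e4)) + t ^+ 2 * e4).
Proof.
rewrite /e1 /e2 /e3 /e4 /f1 /f2 /f3 /f4.
by case=> [[-> ->]|[-> -> -> ->]|[-> -> -> ->]]; split; ring.
Qed.

Lemma pair_gf_rec_diag (r : nat) (d n a : int) : (0 < r)%N -> 0 <= d ->
  pair_gf r d (n + 1) a (n + 1) a =
  pair_gfEE r d (n + 1) a + pair_gfEN r d (n + 1) a + pair_gfNE r d (n + 1) a
  + (pair_gf r d n a n a - pair_gfEE r d n a - pair_gfEN r d n a - pair_gfNE r d n a
     + tq n * (pair_gfEN r d n a + pair_gfNE r d n a) + tq n ^+ 2 * pair_gfEE r d n a).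
Proof.
move=> r0 d0; rewrite /pair_gfEN /pair_gfNE /pair_gfEE addrK /pair_gf.
have -> : a - 1 - d = a - d - 1 by ring.
rewrite -!mul_polyC.
have H : let g := array_gf r%:Z in let h := array_gf (- r%:Z) in let D := a - d in
  [\/ g a (n + 1 - a) = g (a - 1) (n - (a - 1)) + g a (n - a)
         - (1 - tq n) * g (a - 1) (n - 1 - (a - 1)) /\
      h D (n + 1 - D) = h (D - 1) (n - (D - 1)) + h D (n - D)
         - (1 - tq n) * h (D - 1) (n - 1 - (D - 1)),
      [/\ g a (n + 1 - a) = 0, g (a - 1) (n - (a - 1)) = 0, g a (n - a) = 0
        & g (a - 1) (n - 1 - (a - 1)) = 0] |
      [/\ h D (n + 1 - D) = 0, h (D - 1) (n - (D - 1)) = 0, h D (n - D) = 0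
        & h (D - 1) (n - 1 - (D - 1)) = 0]].
  move=> g h D; rewrite {}/g {}/h {}/D.
  (* The recurrences can fail only here: at a = 0 the factor of index -r vanishes, as a - d <= 0 <
     r; at n + 1 - (a - d) = 0 the factor of index r does, as n + 1 - a <= 0 < r. *)
  have [a0|a0] := boolP (a == 0).
    by apply: Or33; split; apply: array_gf_eq0; lia.
  have [v0|v0] := boolP (n + 1 - (a - d) == 0).
    by apply: Or32; split; apply: array_gf_eq0; lia.
  by apply: Or31; split; apply: array_gf_diag_rec; lia.
by case: ifP => _; have [H1 H2] := diag_rec_identity (q ^ (r%:Z * (r%:Z + d)))%:P H;
  [exact: H2|exact: H1].
Qed.

Lemma pair_gf_shift (r : nat) (d a v : int) : 0 <= d ->
  q ^ (r.+1%:Z * (r.+1%:Z + d)) *: (array_gf r.+1%:Z (a - 1) v *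
    (array_gf (- r.+1%:Z) (a - d) (v + d) - array_gf (- r.+1%:Z) (a - d - 1) (v + d)))
  = q ^ (r%:Z * (r%:Z + d)) *: ((array_gf r%:Z a v - array_gf r%:Z (a - 1) v)
    * array_gf (- r%:Z) (a - d - 1) (v + d)).
Proof.
move=> d0; rewrite [in LHS]array_gf_subl; last by lia.
have -> : - r.+1%:Z + 1 = - r%:Z by lia.
have [a0|a0] := boolP (a == 0).
  have -> : array_gf (- r%:Z) (a - d - 1) (v + d) = 0 by apply: array_gf_eq0; lia.
  by rewrite !mulr0 !scaler0 mulr0 scaler0.
rewrite array_gf_subl ?a0// -scalerAl -scalerAr !scalerA -!qexpD.
have -> : r%:Z + 1 = r.+1%:Z by lia.
by congr (q ^ _ *: _); [lia|ring].
Qed.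

Lemma pair_gf_shiftEN (r : nat) (d n a : int) : odd r -> 0 <= d ->
  pair_gfEN r.+1 d n a = pair_gfEN r d n a.
Proof.
move=> r1 d0; rewrite /pair_gfEN /pair_gfEE /pair_gf /= r1 /= -!scalerBr -mulrBr -mulrBl.
have -> : n - 1 - (a - 1) = n - a by ring.
have -> : a - 1 - d = a - d - 1 by ring.
have -> : n - (a - d) = n - a + d by ring.
have -> : n - 1 - (a - d - 1) = n - a + d by ring.
exact: pair_gf_shift.
Qed.

Lemma pair_gf_shiftNE (r : nat) (d n a : int) : ~~ odd r -> 0 <= d ->
  pair_gfNE r.+1 d n a = pair_gfNE r d n a.
Proof.
move=> r1 d0; rewrite /pair_gfNE /pair_gfEE /pair_gf /= r1 (negbTE r1) /=.
rewrite -!scalerBr -mulrBr -mulrBl.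
have -> : n - 1 - (a - 1) = n - a by ring.
have -> : a - 1 - d = a - d - 1 by ring.
have -> : n - (a - d) = n - a + d by ring.
have -> : n - 1 - (a - d - 1) = n - a + d by ring.
exact: pair_gf_shift.
Qed.

(** * Sign changes and recurrences for pairs of paths *)

Fixpoint words (n : nat) : seq (seq step) :=
  if n is m.+1 then map (cons stepE) (words m) ++ map (cons stepN) (words m)
  else [:: [::]].

Lemma mem_words n w : (w \in words n) = (size w == n).
Proof.
elim: n w => [|n IH] [|e w] //=; rewrite mem_cat.
  by apply/negP => /orP[] /mapP[].
rewrite eqSS -IH; have inj b : injective (cons b : seq step -> seq step) by move=> ? ? [].
case: e; rewrite (mem_map (inj _)) -?[true :: _]/(stepE :: _) -?[false :: _]/(stepN :: _).
  by rewrite orbC; case: mapP => // -[].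
by case: mapP => // -[].
Qed.

Lemma uniq_words n : uniq (words n).
Proof.
elim: n => [|n IH] //=.
have inj b : injective (cons b : seq step -> seq step) by move=> ? ? [].
rewrite cat_uniq !map_inj_uniq// IH andbT /=.
by apply/hasPn => _ /mapP[w _ ->]; apply/mapP => -[].
Qed.

(* Words are read backwards: the head is the last step of the path. *)
Fixpoint weight (w : seq step) : {poly Qq} :=
  if w is e :: w' then
    weight w' * (if ~~ e && head stepN w' then tq (size w') else 1)
  else 1.

Definition ecount (w : seq step) : int := (count id w)%:Z.

Definition gap (d : int) (w1 w2 : seq step) : int := d + ecount w2 - ecount w1.

(* Sign changes of the gap, which counts as positive at the beginning; so the
   parity of the result is the sign of the last nonzero gap. *)
Fixpoint sign_changes (d : int) (w1 w2 : seq step) : nat :=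
  if (w1, w2) is (_ :: v1, _ :: v2) then
    let c := sign_changes d v1 v2 in
    (c + nat_of_bool (if odd c then (0 < gap d w1 w2)%R else (gap d w1 w2 < 0)%R))%N
  else 0.

(** Words are reversed, so [drop] removes the last steps of the longer path and the gap is followed
    along the common length only. *)
Definition trunc_changes (d : int) (w1 w2 : seq step) : nat :=
  sign_changes d (drop (size w1 - size w2) w1) (drop (size w2 - size w1) w2).

Lemma ecount_cons e w : ecount (e :: w) = (e : bool)%:Z + ecount w.
Proof. by rewrite /ecount /=; lia. Qed.

Lemma ecount_drop k w :
  ecount (drop k w) <= ecount w <= ecount (drop k w) + k%:Z.
Proof.
have := congr1 (count id) (cat_take_drop k w); rewrite count_cat /ecount => <-.
have := count_size id (take k w); rewrite size_take_min.
lia.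
Qed.

Lemma gapC d w1 w2 : gap (- d) w2 w1 = - gap d w1 w2.
Proof. by rewrite /gap; ring. Qed.

(** If the new step is not truncated away, it adds one gap, which [end_order] forces to be >= 0 for
    odd r and <= 0 for even r. Such a gap can only raise c to a value of parity opposite to r, so c
    does not pass from r - 1 to r. *)
Lemma trunc_changes_consl r d e w1 w2 :
  end_order r (size w1).+1 (ecount (e :: w1)) (size w2) (ecount w2 + d) ->
  (r <= trunc_changes d (e :: w1) w2)%N = (r <= trunc_changes d w1 w2)%N.
Proof.
move=> ord; rewrite /trunc_changes [size (e :: w1)]/=.
have [le21|lt12] := leqP (size w2) (size w1).
  have -> : ((size w1).+1 - size w2 = (size w1 - size w2).+1)%N by lia.
  have -> : (size w2 - (size w1).+1 = size w2 - size w1)%N by lia.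
  by [].
have -> : ((size w1).+1 - size w2 = 0)%N by lia.
have -> : (size w1 - size w2 = 0)%N by lia.
have e2 : (size w2 - size w1 = (size w2 - (size w1).+1).+1)%N by lia.
rewrite e2 !drop0; set k := (size w2 - (size w1).+1)%N.
have /andP[h1 h2] := ecount_drop k w2.
have -> : drop k.+1 w2 = behead (drop k w2) by rewrite -drop1 drop_drop add1n.
have : size (drop k w2) = (size w1).+1 by rewrite size_drop /k; lia.
move: h1 h2; case: (drop k w2) => // f v2 h1 h2 [sv2] /=.
move: ord; rewrite /end_order /gap.
move: h1 h2; have := sv2; rewrite /k; set c := sign_changes _ _ _.
move: (ecount _) (ecount _) (ecount _) => x y z _ h1 h2.
by case: ifP => or; case: ifP => oc /andP[o1 o2]; case: ltrP => //= ?; lia.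
Qed.

Lemma trunc_changes_consr r d e w1 w2 :
  end_order r (size w1) (ecount w1) (size w2).+1 (ecount (e :: w2) + d) ->
  (r <= trunc_changes d w1 (e :: w2))%N = (r <= trunc_changes d w1 w2)%N.
Proof.
move=> ord; rewrite /trunc_changes [size (e :: w2)]/=.
have [le12|lt21] := leqP (size w1) (size w2).
  have -> : ((size w2).+1 - size w1 = (size w2 - size w1).+1)%N by lia.
  have -> : (size w1 - (size w2).+1 = size w1 - size w2)%N by lia.
  by [].
have -> : ((size w2).+1 - size w1 = 0)%N by lia.
have -> : (size w2 - size w1 = 0)%N by lia.
have e1 : (size w1 - size w2 = (size w1 - (size w2).+1).+1)%N by lia.
rewrite e1 !drop0; set k := (size w1 - (size w2).+1)%N.
have /andP[h1 h2] := ecount_drop k w1.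
have -> : drop k.+1 w1 = behead (drop k w1) by rewrite -drop1 drop_drop add1n.
have : size (drop k w1) = (size w2).+1 by rewrite size_drop /k; lia.
move: h1 h2; case: (drop k w1) => // f v1 h1 h2 [sv1] /=.
move: ord; rewrite /end_order /gap.
move: h1 h2; have := sv1; rewrite /k; set c := sign_changes _ _ _.
move: (ecount _) (ecount _) (ecount _) => x y z _ h1 h2.
by case: ifP => or; case: ifP => oc /andP[o1 o2]; case: ltrP => //= ?; lia.
Qed.

Lemma trunc_changes_size d w1 w2 : size w1 = size w2 ->
  trunc_changes d w1 w2 = sign_changes d w1 w2.
Proof. by move=> sw; rewrite /trunc_changes sw subnn !drop0. Qed.

Lemma odd_sign_changes d w1 w2 : 0 <= d -> size w1 = size w2 ->
  (0 < gap d w1 w2 -> ~~ odd (sign_changes d w1 w2)) /\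
  (gap d w1 w2 < 0 -> odd (sign_changes d w1 w2)).
Proof.
move=> d0; elim: w1 w2 => [|e1 w1 IH] [|e2 w2] //=.
  by rewrite /gap /ecount /=; split => //; lia.
move=> [/IH[_ _]]; set c := sign_changes _ _ _; set g := gap _ _ _.
by case: ifP => oc; split; rewrite oddD oc; case: (ltrgtP 0 g).
Qed.

(** * Sums over pairs of words and removal of last steps *)

Definition wsum (phi : seq step -> seq step -> {poly Qq}) (n1 n2 : nat) :=
  \sum_(w1 <- words n1) \sum_(w2 <- words n2) phi w1 w2.

Lemma eq_wsum phi psi n1 n2 :
  (forall w1 w2, size w1 = n1 -> size w2 = n2 -> phi w1 w2 = psi w1 w2) ->
  wsum phi n1 n2 = wsum psi n1 n2.
Proof.
move=> H; apply: eq_big_seq => w1; rewrite mem_words => /eqP s1.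
by apply: eq_big_seq => w2; rewrite mem_words => /eqP s2; exact: H.
Qed.

Lemma wsumSl phi n1 n2 : wsum phi n1.+1 n2 =
  wsum (fun w1 w2 => phi (stepE :: w1) w2) n1 n2
  + wsum (fun w1 w2 => phi (stepN :: w1) w2) n1 n2.
Proof. by rewrite /wsum big_cat !big_map. Qed.

Lemma wsumSr phi n1 n2 : wsum phi n1 n2.+1 =
  wsum (fun w1 w2 => phi w1 (stepE :: w2)) n1 n2
  + wsum (fun w1 w2 => phi w1 (stepN :: w2)) n1 n2.
Proof.
by rewrite /wsum -big_split; apply: eq_bigr => w1 _; rewrite big_cat !big_map.
Qed.

Lemma wsumD phi psi n1 n2 :
  wsum (fun w1 w2 => phi w1 w2 + psi w1 w2) n1 n2 = wsum phi n1 n2 + wsum psi n1 n2.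
Proof. by rewrite /wsum -big_split; apply: eq_bigr => w1 _; rewrite big_split. Qed.

Lemma wsumM c phi n1 n2 :
  wsum (fun w1 w2 => c * phi w1 w2) n1 n2 = c * wsum phi n1 n2.
Proof. by rewrite /wsum mulr_sumr; apply: eq_bigr => w1 _; rewrite mulr_sumr. Qed.

Lemma wsum0 phi n1 n2 :
  (forall w1 w2, size w1 = n1 -> size w2 = n2 -> phi w1 w2 = 0) -> wsum phi n1 n2 = 0.
Proof.
by move=> /eq_wsum ->; rewrite /wsum big1// => w1 _; rewrite big1.
Qed.

Definition term (r : nat) (d a b : int) (w1 w2 : seq step) : {poly Qq} :=
  weight w1 * weight w2 *+
    [&& ecount w1 == a, ecount w2 + d == b & (r <= trunc_changes d w1 w2)%N].

Definition term_gf r d n1 a n2 b := wsum (term r d a b) n1 n2.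

Lemma term_consEl r d a b w1 w2 :
  end_order r (size w1).+1 a (size w2) b ->
  term r d a b (stepE :: w1) w2 = term r d (a - 1) b w1 w2.
Proof.
move=> ord; rewrite /term /= mulr1 ecount_cons.
have -> : (1 + ecount w1 == a) = (ecount w1 == a - 1) by lia.
have [/eqP ea|//] := boolP (ecount w1 == a - 1).
have [/eqP eb|//] := boolP (ecount w2 + d == b).
by rewrite /= trunc_changes_consl// ecount_cons ea eb addrC subrK.
Qed.

Lemma term_consEr r d a b w1 w2 :
  end_order r (size w1) a (size w2).+1 b ->
  term r d a b w1 (stepE :: w2) = term r d a (b - 1) w1 w2.
Proof.
move=> ord; rewrite /term /= mulr1 ecount_cons.
have -> : (1 + ecount w2 + d == b) = (ecount w2 + d == b - 1) by lia.
have [/eqP ea|//] := boolP (ecount w1 == a).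
have [/eqP eb|//] := boolP (ecount w2 + d == b - 1).
have e : 1 + ecount w2 + d = b by lia.
by rewrite /= trunc_changes_consr// ecount_cons ea e.
Qed.

Definition valley (n : nat) (w : seq step) : {poly Qq} :=
  if head stepN w then tq n else 1.

Lemma term_consNl r d a b w1 w2 :
  end_order r (size w1).+1 a (size w2) b ->
  term r d a b (stepN :: w1) w2 = valley (size w1) w1 * term r d a b w1 w2.
Proof.
move=> ord; rewrite /term /= mulrnAr -[if _ then _ else _]/(valley _ _).
rewrite [weight w1 * valley _ _]mulrC -mulrA ecount_cons add0r.
have [/eqP ea|] := boolP (ecount w1 == a); last by rewrite !mulr0n.
have [/eqP eb|] := boolP (ecount w2 + d == b); last by rewrite !mulr0n.
by rewrite /= trunc_changes_consl// ecount_cons ea eb add0r.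
Qed.

Lemma term_consNr r d a b w1 w2 :
  end_order r (size w1) a (size w2).+1 b ->
  term r d a b w1 (stepN :: w2) = valley (size w2) w2 * term r d a b w1 w2.
Proof.
move=> ord; rewrite /term /= mulrnAr mulrA -[if _ then _ else _]/(valley _ _).
rewrite [in LHS]mulrC ecount_cons add0r.
have [/eqP ea|] := boolP (ecount w1 == a); last by rewrite !mulr0n.
have [/eqP eb|] := boolP (ecount w2 + d == b); last by rewrite !mulr0n.
by rewrite /= trunc_changes_consr// ecount_cons add0r ea eb.
Qed.

Definition term_gf_pred1 r d (n1 : nat) a n2 b :=
  if n1 is m.+1 then term_gf r d m (a - 1) n2 b else 0.

Definition term_gf_pred2 r d n1 a (n2 : nat) b :=
  if n2 is m.+1 then term_gf r d n1 a m (b - 1) else 0.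

Lemma term_gf_headEl r d (n1 : nat) a (n2 : nat) b : end_order r n1 a n2 b ->
  wsum (fun w1 w2 => term r d a b w1 w2 *+ (head stepN w1 : bool)) n1 n2 =
  term_gf_pred1 r d n1 a n2 b.
Proof.
case: n1 => [|n1] ord; first by apply: wsum0 => -[].
rewrite wsumSl [X in _ + X]wsum0// addr0; apply: eq_wsum => w1 w2 s1 s2.
by rewrite term_consEl// s1 s2.
Qed.

Lemma term_gf_headEr r d (n1 : nat) a (n2 : nat) b : end_order r n1 a n2 b ->
  wsum (fun w1 w2 => term r d a b w1 w2 *+ (head stepN w2 : bool)) n1 n2 =
  term_gf_pred2 r d n1 a n2 b.
Proof.
case: n2 => [|n2] ord; first by apply: wsum0 => w1 [].
rewrite wsumSr [X in _ + X]wsum0// addr0; apply: eq_wsum => w1 w2 s1 s2.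
by rewrite term_consEr// s1 s2.
Qed.

Lemma valleyE n w (x : {poly Qq}) :
  valley n w * x = x + (tq n - 1) * (x *+ (head stepN w : bool)).
Proof. by rewrite /valley; case: (head _ w); rewrite ?mulr1n ?mulr0n; ring. Qed.

(** A last E is stripped directly. A last N contributes [tq n1] exactly when preceded by E, that is
    1 plus [tq n1 - 1] on words ending with E; stripping that E gives the third term. *)
Lemma term_gf_recl r d (n1 : nat) a (n2 : nat) b :
  end_order r n1.+1 a n2 b -> end_order r n1 a n2 b ->
  term_gf r d n1.+1 a n2 b = term_gf r d n1 (a - 1) n2 b
    + term_gf r d n1 a n2 b - (1 - tq n1) * term_gf_pred1 r d n1 a n2 b.
Proof.
move=> o1 o2; rewrite -term_gf_headEl// -addrA -mulNr opprB -wsumM -wsumD.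
rewrite /term_gf wsumSl; congr (_ + _); apply: eq_wsum => w1 w2 s1 s2.
  by rewrite term_consEl// s1 s2.
by rewrite term_consNl ?s1 ?s2// valleyE.
Qed.

Lemma term_gf_recr r d (n1 : nat) a (n2 : nat) b :
  end_order r n1 a n2.+1 b -> end_order r n1 a n2 b ->
  term_gf r d n1 a n2.+1 b = term_gf r d n1 a n2 (b - 1)
    + term_gf r d n1 a n2 b - (1 - tq n2) * term_gf_pred2 r d n1 a n2 b.
Proof.
move=> o1 o2; rewrite -term_gf_headEr// -addrA -mulNr opprB -wsumM -wsumD.
rewrite /term_gf wsumSr; congr (_ + _); apply: eq_wsum => w1 w2 s1 s2.
  by rewrite term_consEr// s1 s2.
by rewrite term_consNr ?s1 ?s2// valleyE.
Qed.

(* Both paths end at the same point, with last steps x and y; an empty path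
   counts as ending with N. *)
Definition term_gf_last r d (x y : step) n a := wsum (fun w1 w2 =>
  term r d a a w1 w2 *+ ((head stepN w1 == x) && (head stepN w2 == y))) n n.

Lemma term_gf_lastS r d x y n a : term_gf_last r d x y n.+1 a =
  wsum (fun w1 w2 => term r d a a (x :: w1) (y :: w2)) n n.
Proof.
rewrite /term_gf_last wsumSl !wsumSr -!wsumD; apply: eq_wsum => w1 w2 _ _ /=.
by case: x; case: y; rewrite /= ?mulr0n ?mulr1n ?addr0 ?add0r.
Qed.

Lemma term_gf_last0 r d x y a : x || y -> term_gf_last r d x y 0 a = 0.
Proof. by move=> xy; apply: wsum0 => -[|//] [|//] _ _; case: x y xy => -[]. Qed.

Lemma term_gf_split r d n a : term_gf r d n a n a =
  term_gf_last r d stepE stepE n a + term_gf_last r d stepE stepN n a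
  + term_gf_last r d stepN stepE n a + term_gf_last r d stepN stepN n a.
Proof.
rewrite /term_gf_last -!wsumD; apply: eq_wsum => w1 w2 _ _.
by case: (head _ w1); case: (head _ w2); rewrite /= ?mulr0n ?mulr1n ?addr0 ?add0r.
Qed.

Lemma trunc_changes_cons2 d e1 e2 w1 w2 : size w1 = size w2 ->
  gap d (e1 :: w1) (e2 :: w2) = 0 ->
  trunc_changes d (e1 :: w1) (e2 :: w2) = trunc_changes d w1 w2.
Proof.
move=> sw g0; rewrite !trunc_changes_size//= ?sw// g0.
by case: ifP; rewrite ltxx addn0.
Qed.

Lemma term_gf_lastEE r d n a :
  term_gf_last r d stepE stepE n.+1 a = term_gf r d n (a - 1) n (a - 1).
Proof.
rewrite term_gf_lastS; apply: eq_wsum => w1 w2 s1 s2.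
rewrite /term /= !mulr1 !ecount_cons.
have -> : (1 + ecount w1 == a) = (ecount w1 == a - 1) by lia.
have -> : (1 + ecount w2 + d == a) = (ecount w2 + d == a - 1) by lia.
have [/eqP ea|//] := boolP (ecount w1 == a - 1).
have [/eqP eb|//] := boolP (ecount w2 + d == a - 1).
by rewrite trunc_changes_cons2 ?s1 ?s2// /gap !ecount_cons; lia.
Qed.

(** Removing both N keeps the ends equal; each path that then ends with E loses a valley at position
    n. *)
Lemma term_gf_lastNN r d n a :
  term_gf_last r d stepN stepN n.+1 a = term_gf_last r d stepN stepN n a
  + tq n * (term_gf_last r d stepE stepN n a + term_gf_last r d stepN stepE n a)
  + tq n ^+ 2 * term_gf_last r d stepE stepE n a.
Proof.
rewrite term_gf_lastS /term_gf_last -!wsumD -!wsumM -!wsumD.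
apply: eq_wsum => w1 w2 s1 s2; rewrite /term /= !ecount_cons !add0r.
have [/eqP ea|_] := boolP (ecount w1 == a); last first.
  by rewrite !mulr0n ?mul0rn ?addr0 ?mulr0 ?addr0.
have [/eqP eb|_] := boolP (ecount w2 + d == a); last first.
  by rewrite !mulr0n ?mul0rn ?addr0 ?mulr0 ?addr0.
rewrite trunc_changes_cons2 ?s1 ?s2//; last by rewrite /gap !ecount_cons; lia.
rewrite -![if _ then _ else _]/(valley _ _) /valley.
case: (head _ w1); case: (head _ w2); case: (r <= _)%N;
  rewrite /= ?mulr0n ?mulr1n ?mul0rn; ring.
Qed.

(** Without its last E the path from A1 ends just west of the other one, which is the order for odd
    r; the pairs whose second path ends with E are subtracted. *)
Lemma term_gf_lastEN r d n a : odd r -> term_gf_last r d stepE stepN n.+1 a =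
  term_gf r d n (a - 1) n.+1 a - term_gf r d n (a - 1) n (a - 1).
Proof.
move=> r1; rewrite term_gf_lastS /term_gf wsumSr.
rewrite [X in _ = X + _ - _](@eq_wsum _ (term r d (a - 1) (a - 1)) n n); last first.
  by move=> w1 w2 s1 s2; rewrite term_consEr// s1 s2 /end_order r1; lia.
rewrite addrC addKr; apply: eq_wsum => w1 w2 s1 s2.
by rewrite term_consEl//= s1 s2 /end_order r1; lia.
Qed.

Lemma term_gf_lastNE r d n a : ~~ odd r -> term_gf_last r d stepN stepE n.+1 a =
  term_gf r d n.+1 a n (a - 1) - term_gf r d n (a - 1) n (a - 1).
Proof.
move=> r1; rewrite term_gf_lastS /term_gf wsumSl.
rewrite [X in _ = X + _ - _](@eq_wsum _ (term r d (a - 1) (a - 1)) n n); last first.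
  by move=> w1 w2 s1 s2; rewrite term_consEl// s1 s2 /end_order (negbTE r1); lia.
rewrite addrC addKr; apply: eq_wsum => w1 w2 s1 s2.
by rewrite term_consEr//= s1 s2 /end_order (negbTE r1); lia.
Qed.

(* Before the last steps the gap has the sign for which c and r differ in
   parity, so that r <= c implies r < c. *)
Lemma term_gf_last_succ r d x y n a : 0 <= d ->
  (x, y) = (if odd r then (stepE, stepN) else (stepN, stepE)) ->
  term_gf_last r.+1 d x y n.+1 a = term_gf_last r d x y n.+1 a.
Proof.
move=> d0 xy; rewrite !term_gf_lastS; apply: eq_wsum => w1 w2 s1 s2.
rewrite /term; have [/eqP ea|//] := boolP (ecount (x :: w1) == a).
have [/eqP eb|//] := boolP (ecount (y :: w2) + d == a).
have sw : size w1 = size w2 by rewrite s1 s2.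
rewrite trunc_changes_cons2 ?trunc_changes_size//; last by rewrite /gap; lia.
have [gpos gneg] := odd_sign_changes d0 sw.
move: ea eb; rewrite !ecount_cons => ea eb; congr (_ *+ _).
rewrite [(r <= sign_changes d w1 w2)%N]leq_eqVlt; case: (r =P _) => [rc|//].
move: xy gpos gneg ea eb; rewrite -rc.
case: ifP => r1 [-> ->] gpos gneg /= ea eb.
  by have := gpos _; rewrite /gap; lia.
by have := gneg _; rewrite /gap; lia.
Qed.

(** * The generating function of pairs with at least r sign changes *)

Definition path_gf (n : nat) (a : int) : {poly Qq} :=
  \sum_(w <- words n) weight w *+ (ecount w == a).

Lemma path_gf_rec (n : nat) a : path_gf n.+1 a = path_gf n (a - 1) + path_gf n a
  - (1 - tq n) * (if n is m.+1 then path_gf m (a - 1) else 0).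
Proof.
have headE : \sum_(w <- words n) weight w *+ (ecount w == a) *+ (head stepN w : bool) =
    if n is m.+1 then path_gf m (a - 1) else 0.
  case: n => [|n]; first by rewrite big_seq1.
  rewrite big_cat !big_map [X in _ + X = _]big1 ?addr0//; apply: eq_bigr => w _.
  rewrite /= mulr1 ecount_cons mulr1n; congr (_ *+ nat_of_bool _). rewrite /stepE; lia.
rewrite -headE /path_gf -addrA -mulNr opprB mulr_sumr -big_split [in LHS]big_cat !big_map.
congr (_ + _); apply: eq_big_seq => w; rewrite mem_words => /eqP sw.
  by rewrite /= mulr1 ecount_cons; congr (_ *+ nat_of_bool _); rewrite /stepE; lia.
rewrite /= ecount_cons add0r mulrnAr mulrC -mulrnAr -valleyE sw.
by rewrite -[if _ then _ else _]/(valley _ _) mulrnAr.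
Qed.

Lemma path_gf0E a : path_gf 0 a = array_gf 0 a (0 - a).
Proof.
rewrite /path_gf big_seq1 /=; have [/eqP <-|a0] := boolP (ecount [::] == a); last first.
  rewrite array_gf_eq0; first by rewrite mulr0n.
  by move: a0; rewrite /ecount /=; lia.
apply/polyP => i; rewrite coef_array_gf mulr1n coefC.
case: i => [|i]; last by rewrite (@qbinom_eq0 (ecount [::]) i.+1%:Z)// mulr0 ?mul0r.
by rewrite !qbinom0// mul0r expr0z !mulr1.
Qed.

(** Both sides satisfy one recurrence. It reaches two lengths back, hence the strong induction; the
    term of length -1 is zero. *)
Lemma path_gfE (n : nat) a : path_gf n a = array_gf 0 a (n%:Z - a).
Proof.
have [N nN] := ubnP n; elim: N n nN a => // N IH [|n] nN a; first exact: path_gf0E.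
rewrite path_gf_rec -[n.+1]addn1 PoszD array_gf_diag_rec; last by lia.
rewrite !IH; try lia; congr (_ + _ - _ * _).
case: n nN => [|n] nN; first by rewrite array_gf_eq0//; lia.
by rewrite IH; [congr (array_gf _ _ _); lia|lia].
Qed.

Lemma term_gf0 d (n1 n2 : nat) a b : term_gf 0 d n1 a n2 b = pair_gf 0 d n1 a n2 b.
Proof.
rewrite /pair_gf /= mul0r expr0z scale1r oppr0 -!path_gfE /term_gf /wsum mulr_suml.
apply: eq_bigr => w1 _; rewrite mulr_sumr; apply: eq_bigr => w2 _.
rewrite /term leq0n andbT.
have -> : (ecount w2 + d == b) = (ecount w2 == b - d) by lia.
by case: (_ == a); case: (_ == _); rewrite ?mulr0n ?mulr1n ?mulr0 ?mul0r.
Qed.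

Lemma term_gf_nil r d (n1 n2 : nat) a b : (0 < r)%N -> (n1 == 0%N) || (n2 == 0%N) ->
  term_gf r d n1 a n2 b = 0.
Proof.
move=> r0 n0; apply: wsum0 => w1 w2 s1 s2; rewrite /term.
have -> : trunc_changes d w1 w2 = 0%N.
  case/orP: n0 => /eqP n0.
    have -> : w1 = [::] by apply: size0nil; rewrite s1.
    by [].
  have -> : w2 = [::] by apply: size0nil; rewrite s2.
  by rewrite /trunc_changes /=; case: (drop _ _).
by rewrite leqNgt r0 !andbF mulr0n.
Qed.

Lemma pair_gf_neg r d n1 a n2 b : (n1 < 0) || (n2 < 0) -> pair_gf r d n1 a n2 b = 0.
Proof.
move=> n0; rewrite /pair_gf.
have H k u n : n < 0 -> array_gf k u (n - u) = 0.
  by move=> nn; apply: array_gf_eq0; lia.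
case/orP: n0 => n0; case: ifP => _.
- by rewrite (H _ (a - d) n1)// mulr0 scaler0.
- by rewrite (H _ a n1)// mul0r scaler0.
- by rewrite (H _ b n2)// mul0r scaler0.
- by rewrite (H _ (b - d) n2)// mulr0 scaler0.
Qed.

Lemma predzS (n : nat) : n.+1%:Z - 1 = n%:Z.
Proof. by lia. Qed.

(** * Coinciding endpoints, inside the induction on the total length *)

Section Diagonal.
Variables (N : nat) (d : int).
Hypothesis d0 : 0 <= d.
Hypothesis IH : forall r (n1 n2 : nat) a b, (n1 + n2 < N)%N ->
  end_order r n1 a n2 b -> term_gf r d n1 a n2 b = pair_gf r d n1 a n2 b.

Lemma lastEE_eq r (n : nat) a : (n + n <= N)%N ->
  term_gf_last r d stepE stepE n a = pair_gfEE r d n a.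
Proof.
case: n => [|n] nN; first by rewrite term_gf_last0// /pair_gfEE pair_gf_neg.
rewrite term_gf_lastEE IH; [|lia|by rewrite /end_order; case: ifP; lia].
by rewrite /pair_gfEE predzS.
Qed.

Lemma lastEN_odd r (n : nat) a : odd r -> (n + n <= N)%N ->
  term_gf_last r d stepE stepN n a = pair_gfEN r d n a.
Proof.
move=> r1; case: n => [|n] nN.
  by rewrite term_gf_last0// /pair_gfEN /pair_gfEE !pair_gf_neg ?subrr.
rewrite term_gf_lastEN// !IH ?/end_order ?r1; try lia.
by rewrite /pair_gfEN /pair_gfEE predzS.
Qed.

Lemma lastNE_even r (n : nat) a : ~~ odd r -> (n + n <= N)%N ->
  term_gf_last r d stepN stepE n a = pair_gfNE r d n a.
Proof.
move=> r1; case: n => [|n] nN.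
  by rewrite term_gf_last0// /pair_gfNE /pair_gfEE !pair_gf_neg ?subrr.
rewrite term_gf_lastNE// !IH ?/end_order ?(negbTE r1); try lia.
by rewrite /pair_gfNE /pair_gfEE predzS.
Qed.

(** For even level the order forbids stripping the E, but both sides are unchanged when the level
    drops by one ([term_gf_last_succ], [pair_gf_shiftEN]), and odd levels are settled. *)
Lemma lastEN_eq r (n : nat) a : (0 < r)%N -> (n + n <= N)%N ->
  term_gf_last r d stepE stepN n a = pair_gfEN r d n a.
Proof.
case: r => // r _ nN; have [/= r0|/= r1] := boolP (odd r.+1); first exact: lastEN_odd.
move: r1; rewrite negbK => r1; rewrite pair_gf_shiftEN// -lastEN_odd//.
case: n {nN} => [|n]; first by rewrite !term_gf_last0.
by rewrite term_gf_last_succ// r1.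
Qed.

Lemma lastNE_eq r (n : nat) a : (0 < r)%N -> (n + n <= N)%N ->
  term_gf_last r d stepN stepE n a = pair_gfNE r d n a.
Proof.
case: r => // r _ nN; have [/= r0|/= r1] := boolP (odd r.+1); last exact: lastNE_even.
rewrite pair_gf_shiftNE// -lastNE_even//.
case: n {nN} => [|n]; first by rewrite !term_gf_last0.
by rewrite term_gf_last_succ// (negbTE r0).
Qed.

Lemma diag_eq r (n : nat) a : (0 < r)%N -> (n.+1 + n.+1 <= N)%N ->
  term_gf r d n.+1 a n.+1 a = pair_gf r d n.+1 a n.+1 a.
Proof.
move=> r0 nN; rewrite -[in RHS]addn1 PoszD pair_gf_rec_diag//.
have -> : n%:Z + 1%N%:Z = n.+1%:Z by lia.
have nN' : (n + n <= N)%N by lia.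
have -> : pair_gf r d n a n a = term_gf r d n a n a.
  by rewrite IH//; [lia|rewrite /end_order; case: ifP; lia].
rewrite -!lastEE_eq// -!lastEN_eq// -!lastNE_eq// [in LHS]term_gf_split term_gf_lastNN.
rewrite [term_gf r d n a n a]term_gf_split; ring.
Qed.

End Diagonal.

Lemma term_gfE r d (n1 n2 : nat) a b : 0 <= d -> end_order r n1 a n2 b ->
  term_gf r d n1 a n2 b = pair_gf r d n1 a n2 b.
Proof.
move=> d0; have [N nN] := ubnP (n1 + n2)%N; elim: N r n1 n2 a b nN => // N IH.
case=> [|r] n1 n2 a b nN ord; first exact: term_gf0.
have [n0|] := boolP ((n1 == 0%N) || (n2 == 0%N)).
  by rewrite term_gf_nil// pair_gf_eq0//; case/orP: n0 => /eqP ->; rewrite ?orbT.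
case: n1 n2 nN ord => [|n1] [|n2] // nN ord _.
have [/andP[o1 o2]|nl] := boolP
    (end_order r.+1 n1 a n2.+1 b && end_order r.+1 n1 (a - 1) n2.+1 b).
  rewrite term_gf_recl// -[n1.+1]addn1 PoszD pair_gf_recl// !IH//; try lia.
  congr (_ + _ - _ * _); case: n1 o1 o2 nN {ord} => [|n1] o1 o2 nN.
    by rewrite pair_gf_neg.
  rewrite /term_gf_pred1 IH; first by rewrite predzS.
    by lia.
  by move: o1 o2; rewrite /end_order; case: ifP; lia.
have [/andP[o1 o2]|nr] := boolP
    (end_order r.+1 n1.+1 a n2 b && end_order r.+1 n1.+1 a n2 (b - 1)).
  rewrite term_gf_recr// -[n2.+1]addn1 PoszD pair_gf_recr// !IH//; try lia.
  congr (_ + _ - _ * _); case: n2 o1 o2 nN {ord nl} => [|n2] o1 o2 nN.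
    by rewrite pair_gf_neg.
  rewrite /term_gf_pred2 IH; first by rewrite predzS.
    by lia.
  by move: o1 o2; rewrite /end_order; case: ifP; lia.
(* Each failed case forces one coordinate of the endpoints to agree: one the abscissas, the other
   the ordinates. *)
have [ab n12] : a = b /\ n1 = n2.
  by move: ord nl nr; rewrite /end_order; case: ifP => _; lia.
by subst b n2; apply: (diag_eq d0 IH).
Qed.

(** * Descents and major index of reversed words *)

Lemma is_descent_rcons A s e i : (i < size s)%N ->
  is_descent (A, rcons s e) i = is_descent (A, s) i.
Proof.
move=> lis; rewrite /is_descent /stepat /len /steps /= size_rcons ltnS (ltnW lis) lis.
by rewrite !nth_rcons lis (leq_ltn_trans (leq_pred i) lis).
Qed.

Lemma is_descent_last A w e :
  is_descent (A, rev (e :: w)) (size w) = ~~ e && head stepN w.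
Proof.
rewrite /is_descent /stepat /len /steps /= size_rev /= ltnSn.
rewrite rev_cons !nth_rcons size_rev ltnn eqxx.
case: w => [|f w] /=; first by rewrite andbF.
by rewrite ltnSn nth_rev// subSS subnn /= andbC; case: e; case: f.
Qed.

Lemma weight_rev A w :
  weight w = q ^+ maj (A, rev w) *: 'X ^+ des (A, rev w).
Proof.
elim: w => [|e w IH]; first by rewrite /maj /des !big_ord0 /= !expr0 scale1r.
have sumE (F : nat -> nat) :
    (\sum_(i < len (A, rev (e :: w)) | is_descent (A, rev (e :: w)) i) F i =
     \sum_(i < len (A, rev w) | is_descent (A, rev w) i) F i
       + (if ~~ e && head stepN w then F (size w) else 0))%N.
  have l1 : len (A, rev (e :: w)) = (size w).+1 by rewrite /len /steps /= size_rev.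
  have l2 : len (A, rev w) = size w by rewrite /len /steps /= size_rev.
  rewrite l1 l2 big_mkcond big_ord_recr /= is_descent_last; congr (_ + _)%N.
  rewrite [RHS]big_mkcond; apply: eq_bigr => i _.
  by rewrite rev_cons is_descent_rcons// size_rev.
rewrite /= {}IH /maj /des (sumE id) (sumE (fun=> 1%N)); case: ifP => _;
  last by rewrite !addn0 mulr1.
by rewrite !exprD expr1 /tq -scalerAl -scalerAr scalerA.
Qed.

Lemma vertexE (A : point) s i : (i <= size s)%N -> vertex (A, s) i =
  (A.1 + ecount (take i s), A.2 + i%:Z - ecount (take i s)).
Proof.
move=> lis; rewrite /vertex /ecount /steps /=.
have cE : count_mem stepE (take i s) = count id (take i s).
  by apply: eq_count => -[].
have cN : (count_mem stepN (take i s) + count id (take i s) = i)%N.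
  rewrite -[RHS](size_takel lis) -(count_predC (pred1 stepN)); congr (_ + _)%N.
  by apply: eq_count => -[].
by rewrite cE; congr (_, _); rewrite -[in i%:Z]cN PoszD; ring.
Qed.

Lemma ecount_rev w : ecount (rev w) = ecount w.
Proof. by rewrite /ecount count_rev. Qed.

Lemma pathsP (A B : point) (n : nat) (A' : point) s : B.1 + B.2 - (A.1 + A.2) = n%:Z ->
  paths A B (A', s) <-> [/\ A' = A, size s = n & ecount s = B.1 - A.1].
Proof.
case: A B A' => [x y] [u v] [x' y'] /= Bn; rewrite /paths /=.
rewrite [vertex _ 0]vertexE// vertexE// take_size take0 /len /steps /ecount /=.
rewrite -/(ecount s); split=> [[[E1 E2] [E3 E4]]|[[-> ->] sn E]].
  by split; [congr pair; lia|lia|lia].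
by split; congr pair; lia.
Qed.

Lemma paths_empty (A B : point) : B.1 + B.2 < A.1 + A.2 -> paths A B = set0.
Proof.
case: A B => [x y] [u v] /= lt; apply/seteqP; split=> // -[[x' y'] s] [/=].
rewrite [vertex _ 0]vertexE// vertexE// /len /steps take0 /ecount /=.
by move=> [? ?] [? ?]; lia.
Qed.

Lemma Hge_wsum r (A1 D1 A2 D2 : point) (n1 n2 : nat) (d : int) :
  D1.1 + D1.2 - (A1.1 + A1.2) = n1%:Z -> D2.1 + D2.2 - (A2.1 + A2.2) = n2%:Z ->
  d = A2.1 - A1.1 ->
  Hge r A1 D1 A2 D2 = wsum (fun w1 w2 => weight w1 * weight w2 *+
    [&& ecount w1 == D1.1 - A1.1, ecount w2 + d == D2.1 - A1.1
      & (r <= crossings (A1, rev w1) (A2, rev w2))%N]) n1 n2.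
Proof.
move=> e1 e2 ->; pose p (x : seq step * seq step) :=
  [&& ecount x.1 == D1.1 - A1.1, ecount x.2 + (A2.1 - A1.1) == D2.1 - A1.1
    & (r <= crossings (A1, rev x.1) (A2, rev x.2))%N].
pose h (x : seq step * seq step) : lpath * lpath := ((A1, rev x.1), (A2, rev x.2)).
pose L := [seq (w1, w2) | w1 <- words n1, w2 <- words n2].
have uL : uniq (map h (filter p L)).
  rewrite map_inj_uniq; last first.
    by move=> [x1 x2] [y1 y2] [/(can_inj (@revK _)) -> /(can_inj (@revK _)) ->].
  by apply/filter_uniq/allpairs_uniq; rewrite ?uniq_words// => -[? ?] [].
rewrite /Hge (_ : [set PQ | _] = [set` map h (filter p L)]).
  rewrite -fsbig_seq// big_map big_filter big_mkcond big_allpairs_dep /wsum.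
  apply: eq_bigr => w1 _; apply: eq_bigr => w2 _.
  rewrite (weight_rev A1 w1) (weight_rev A2 w2) /p /h /=; case: ifP => _.
    by rewrite mulr1n -scalerAl -scalerAr scalerA !exprD.
  by rewrite mulr0n.
apply/seteqP; split=> [[[A1' s1] [A2' s2]] /= [P1 P2 c]|x /= /mapP[[w1 w2]]].
  move/(pathsP _ _ e1): P1 c => [-> z1 c1]; move/(pathsP _ _ e2): P2 => [-> z2 c2] c.
  apply/mapP; exists (rev s1, rev s2); last by rewrite /h /= !revK.
  rewrite mem_filter /p /= !revK c !ecount_rev c1 eqxx c2 /=.
  rewrite allpairs_f ?mem_words ?size_rev ?z1 ?z2 ?eqxx// andbT.
  by lia.
rewrite mem_filter => /andP[/and3P[/= c1 c2 c]] /allpairsP[[v1 v2] /= [m1 m2 [E1 E2]]] ->.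
rewrite {}E1 {}E2 in c1 c2 c *; move: m1 m2; rewrite !mem_words => /eqP s1 /eqP s2.
split=> //; apply/pathsP; [exact: e1| |exact: e2|]; split;
  rewrite ?size_rev ?ecount_rev//.
  by apply/eqP.
by move/eqP: c2 => /= c2; lia.
Qed.

(** * Crossings as sign changes *)

(* A sequence g with steps in {-1, 0, 1} and g 0 >= 0, and the number C i of
   its sign changes up to i. *)
Section SignChanges.
Variables (g : nat -> int) (C : nat -> nat) (m : nat).

Definition flips (e : nat) : bool := if odd (C e) then 0 < g e.+1 else g e.+1 < 0.
(** Separates true sign changes from the first departure from 0 when g starts at 0, which is no
    crossing. *)
Definition nonzero_upto (e : nat) : bool := has (fun l => g l != 0) (iota 0 e.+1).

Lemma nonzero_uptoS e : nonzero_upto e.+1 = nonzero_upto e || (g e.+1 != 0).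
Proof. by rewrite /nonzero_upto -[e.+2]addn1 iotaD has_cat /= orbF add0n. Qed.

Lemma nonzero_upto_mem e l : (l <= e)%N -> g l != 0 -> nonzero_upto e.
Proof. by move=> le gl; apply/hasP; exists l; rewrite // mem_iota. Qed.

Hypothesis C0 : C 0 = 0%N.
Hypothesis CS : forall i, (i < m)%N -> C i.+1 = (C i + flips i)%N.
Hypothesis g0 : 0 <= g 0%N.
Hypothesis gS : forall i, (i < m)%N -> g i - 1 <= g i.+1 <= g i + 1.

Lemma odd_changes i : (i <= m)%N -> g i != 0 -> odd (C i) = (g i < 0).
Proof.
case: i => [|i] im gi; first by rewrite C0; move: g0; lia.
by rewrite CS// oddD oddb /flips; case: ifP => _; lia.
Qed.

Lemma changes_const i e : (i <= e)%N -> (e <= m)%N ->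
  (forall l, (i < l <= e)%N -> g l = 0) -> C e = C i.
Proof.
elim: e => [|e IH] ie em z; first by move: ie; rewrite leqn0 => /eqP ->.
have [->//|ne] := eqVneq i e.+1.
rewrite CS// /flips z ?ltxx ?if_same ?addn0; last by lia.
by apply: IH => [||l le]; [lia|lia|apply: z; lia].
Qed.

(** Shape of a crossing run: a maximal zero run from i to e, entered and left with opposite signs.
    As g moves by at most 1, the two outer values are 1 and -1. *)
Definition sign_switch (i e : nat) : Prop :=
  [/\ (0 < i <= e)%N, forall l, (i <= l <= e)%N -> g l = 0, g i.-1 != 0
    & g e.+1 = - g i.-1].

Lemma last_nonzero e : nonzero_upto e -> exists i,
  [/\ (0 < i <= e.+1)%N, forall l, (i <= l <= e)%N -> g l = 0 & g i.-1 != 0].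
Proof.
elim: e => [|e IH].
  by rewrite /nonzero_upto /= orbF => n0; exists 1%N; split=> // l; lia.
have [ge|ge] := eqVneq (g e.+1) 0.
  rewrite nonzero_uptoS ge eqxx orbF => /IH[i [i0 z gi]].
  exists i; split=> //; first by lia.
  by move=> l le; have [->//|ne] := eqVneq l e.+1; apply: z; lia.
by move=> _; exists e.+2; split=> // [|l]; lia.
Qed.

Lemma sign_switchP e : (e < m)%N ->
  (exists i, sign_switch i e) <-> flips e && nonzero_upto e.
Proof.
move=> em; split=> [[i [ie z gi ge]]|/andP[fe /last_nonzero[i [i0 z gi]]]].
  have oC : odd (C e) = (g i.-1 < 0).
    rewrite -odd_changes//; last by lia.
    by congr odd; apply: changes_const => [||l le]; [lia|lia|apply: z; lia].
  rewrite (@nonzero_upto_mem e i.-1)//; last by lia.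
  by rewrite andbT /flips oC ge; case: ifP; move: gi; lia.
have oC : odd (C e) = (g i.-1 < 0).
  rewrite -odd_changes//; last by lia.
  by congr odd; apply: changes_const => [||l le]; [lia|lia|apply: z; lia].
have := gS em; have im : (i.-1 < m)%N by lia.
have := gS im; rewrite prednK; last by lia.
move: fe; rewrite /flips oC.
(* An empty zero run is impossible: a step of at most 1 cannot reverse a nonzero sign. *)
have [ei|ei] := eqVneq i e.+1.
  by move: gi; rewrite ei /=; case: ifP; lia.
have -> : g i = 0 by apply: z; lia.
have -> : g e = 0 by apply: z; lia.
by move=> fe h1 h2; exists i; split=> //; [lia|move: fe; case: ifP; lia].
Qed.

Lemma changes_sum i : (i <= m)%N -> g 0%N != 0 ->
  C i = (\sum_(e < i) (flips e && nonzero_upto e))%N.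
Proof.
move=> im gn0; elim: i im => [|i IH] im; first by rewrite big_ord0.
by rewrite CS// big_ord_recr /= -IH ?(ltnW im)// (@nonzero_upto_mem i 0%N)// andbT.
Qed.

(* C' counts the sign changes of - g; exactly one of C and C' also counts the
   departure of g from 0. *)
Lemma changes_sum_opp (C' : nat -> nat) : C' 0%N = 0%N ->
  (forall i, (i < m)%N ->
     C' i.+1 =
     (C' i + nat_of_bool (if odd (C' i) then (0 < - g i.+1)%R else (- g i.+1 < 0)%R))%N) ->
  g 0%N = 0 -> let X := (\sum_(e < m) (flips e && nonzero_upto e))%N in
  [/\ C m = 0, C' m = 0 & X = 0]%N \/
  exists b : bool, C m = (X + b)%N /\ C' m = (X + ~~ b)%N.
Proof.
move=> C'0 C'S gz X.
suff H i : (i <= m)%N -> let X := (\sum_(e < i) (flips e && nonzero_upto e))%N in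
    if nonzero_upto i then exists b : bool, C i = (X + b)%N /\ C' i = (X + ~~ b)%N
    else [/\ C i = 0, C' i = 0 & X = 0]%N.
  by move: (H m (leqnn m)) => /=; case: ifP => _ ?; [right|left].
elim: i => [|i IH] im.
  by rewrite /= /nonzero_upto /= gz eqxx big_ord0 C0 C'0.
move: IH => /(_ (ltnW im)) /=; rewrite nonzero_uptoS big_ord_recr /=.
rewrite CS// C'S//; case: ifP => nz /=.
  move=> [b [E1 E2]]; exists b; rewrite andbT /flips.
  have -> : odd (C' i) = ~~ odd (C i)
    by rewrite E1 E2; case: (b); rewrite ?addn0 ?addn1 /= ?negbK.
  by rewrite oppr_gt0 oppr_lt0; case: (odd (C i));
    rewrite /= E1 E2 ![(_ + _ + nat_of_bool (_ < _)%R)%N]addnAC.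
move=> [E1 E2 E3]; rewrite /flips E1 E2 E3 /= andbF oppr_lt0 !add0n.
have [gi|gi] := eqVneq (g i.+1) 0; first by rewrite gi ltxx.
(* The first nonzero value counts for g if negative and for - g if positive. *)
by exists (g i.+1 < 0)%R; split=> //; case: ltrgtP gi.
Qed.

End SignChanges.

(** * The gap sequence of two paths and its crossings *)

Section Crossings.
Variables (d : int) (A1 A2 : point) (s1 s2 : seq step).

Definition prefix_gap i := gap d (rev (take i s1)) (rev (take i s2)).
Definition prefix_changes i := sign_changes d (rev (take i s1)) (rev (take i s2)).
Let m := minn (size s1) (size s2).

Lemma prefix_gap0 : prefix_gap 0 = d.
Proof. by rewrite /prefix_gap !take0 /gap /ecount /=; ring. Qed.

Lemma prefix_gapS i : (i < m)%N -> prefix_gap i.+1 =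
  prefix_gap i + (nth stepN s2 i : bool)%:Z - (nth stepN s1 i : bool)%:Z.
Proof.
rewrite leq_min => /andP[i1 i2]; rewrite /prefix_gap /gap !(take_nth stepN)//.
by rewrite !rev_rcons !ecount_cons; ring.
Qed.

Lemma prefix_changesS i : (i < m)%N ->
  prefix_changes i.+1 = (prefix_changes i + flips prefix_gap prefix_changes i)%N.
Proof.
rewrite leq_min => /andP[i1 i2]; rewrite /flips {1}/prefix_changes.
by rewrite /prefix_gap !(take_nth stepN)// !rev_rcons.
Qed.

Lemma trunc_changes_prefix : trunc_changes d (rev s1) (rev s2) = prefix_changes m.
Proof.
rewrite /trunc_changes /prefix_changes !drop_rev !size_rev /m.
by congr (sign_changes _ (rev (take _ _)) (rev (take _ _))); lia.
Qed.

Lemma prefix_gap_step i : (i < m)%N ->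
  prefix_gap i - 1 <= prefix_gap i.+1 <= prefix_gap i + 1.
Proof. by move=> im; rewrite prefix_gapS//; case: nth; case: nth; lia. Qed.

Hypothesis d_ge0 : 0 <= d.
Hypothesis A2E : A2 = (A1.1 + d, A1.2 - d).

(** The starts share an antidiagonal, so the coordinate sum of a vertex determines its position. *)
Lemma vertex_eq i j : (i <= size s1)%N -> (j <= size s2)%N ->
  (vertex (A1, s1) i == vertex (A2, s2) j) = (i == j) && (prefix_gap i == 0).
Proof.
move=> i1 j2; rewrite !vertexE// A2E xpair_eqE /= /prefix_gap /gap !ecount_rev.
have [<-|ij] := eqVneq i j; first by lia.
by apply/negP => /andP[/eqP h1 /eqP h2]; lia.
Qed.

Lemma is_crossingP e : (e < size s1)%N ->
  is_crossing (A1, s1) (A2, s2) e =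
  (e < m)%N && (flips prefix_gap prefix_changes e && nonzero_upto prefix_gap e).
Proof.
move=> e1; have P0 : 0 <= prefix_gap 0 by rewrite prefix_gap0.
have C0 : prefix_changes 0 = 0%N by rewrite /prefix_changes !take0.
have swP := sign_switchP C0 prefix_changesS P0 prefix_gap_step.
apply/existsP/andP => [[i /existsP[j /existsP[s /andP[/eqP ise]]]]|[em]]; last first.
  move=> /(swP _ em)[i [ie z gi ge]].
  have im : (i < m)%N by lia.
  have im' : (i.-1 < m)%N by lia.
  move: (em) (im); rewrite !leq_min => /andP[_ e2] /andP[i1 i2].
  exists (Ordinal i1); apply/existsP; exists (Ordinal i2).
  have si : (e - i < size s1)%N by lia.
  apply/existsP; exists (Ordinal si); apply/andP; split; first by apply/eqP => /=; lia.
  have ei : (i + (e - i) = e)%N by lia.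
  have zi : prefix_gap i = 0 by apply: z; lia.
  have ze : prefix_gap e = 0 by apply: z; lia.
  rewrite /crossing_run /len /steps /= ei e1 e2 (_ : (0 < i)%N) /=; last by lia.
  apply/and5P; split.
  - apply/forallP => l; have := ltn_ord l => ll.
    by rewrite vertex_eq ?eqxx /= ?z//; lia.
  - by rewrite vertex_eq ?eqxx//=; lia.
  - by rewrite vertex_eq ?eqxx//= ge oppr_eq0.
  (* The gap enters the zero run from 1 or -1 and leaves with the opposite value, which determines
     all four steps. *)
  - have h := prefix_gapS em; have h' := prefix_gapS im'.
    rewrite prednK in h'; last by lia.
    rewrite /stepat /=; move: h h'; rewrite ge zi ze.
    by move: gi; case: nth; case: nth; case: nth; case: nth; rewrite /=; lia.
  - have h := prefix_gapS em; have h' := prefix_gapS im'.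
    rewrite prednK in h'; last by lia.
    rewrite /stepat /=; move: h h'; rewrite ge zi ze.
    by move: gi; case: nth; case: nth; case: nth; case: nth; rewrite /=; lia.
move: ise; move: (nat_of_ord i) (nat_of_ord j) (nat_of_ord s) => {}i {}j {}s ise.
rewrite /crossing_run /len /steps /= ise.
move=> /and5P[i0 j0 _ js /and5P[/forallP V V1 Vs E1 E2]].
have ls : forall l, (l <= s)%N -> (i + l = j + l)%N /\ prefix_gap (i + l) = 0.
  move=> l lls; have lls' : (l < s.+1)%N by [].
  have := V (Ordinal lls'); rewrite /= vertex_eq; [|lia|lia].
  by move=> /andP[/eqP -> /eqP ->].
have [ij _] := ls 0%N isT; rewrite !addn0 in ij.
have em : (e < m)%N by rewrite leq_min e1; move: js; rewrite -ij ise.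
split=> //; apply/(swP _ em); exists i.
have im' : (i.-1 < m)%N by lia.
move: V1 Vs; rewrite -ij ise !vertex_eq ?eqxx/=; try by move: em; rewrite leq_min; lia.
move=> V1 Vs; split=> //; first by lia.
  by move=> l le; have [_] := ls (l - i)%N ltac:(lia); rewrite subnKC//; lia.
have ge : prefix_gap e = 0 by rewrite -ise; have [] := ls s (leqnn s).
have gi : prefix_gap i = 0 by have [] := ls 0%N isT; rewrite addn0.
have h := prefix_gapS em; have h' := prefix_gapS im'.
rewrite prednK// gi in h'; rewrite h ge.
move: E1 E2 h' V1; rewrite /stepat /= -?ij ise => /eqP -> /eqP ->; lia.
Qed.

Lemma crossings_sum : crossings (A1, s1) (A2, s2) =
  (\sum_(e < m) (flips prefix_gap prefix_changes e && nonzero_upto prefix_gap e))%N.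
Proof.
rewrite /crossings cardsE -sum1_card big_mkcond /len /steps /=.
have mw : (m <= size s1)%N by rewrite geq_minl.
rewrite (big_ord_widen _ (fun e : nat => nat_of_bool
  (flips prefix_gap prefix_changes e && nonzero_upto prefix_gap e)) mw).
rewrite [RHS]big_mkcond /=.
apply: eq_bigr => e _.
rewrite -[e \in _]/(is_crossing (A1, s1) (A2, s2) e) is_crossingP//.
by case: (e < m)%N => //=; case: (_ && _).
Qed.

End Crossings.

(** The gap starts at d > 0, so every sign change is a crossing. *)
Lemma crossings_trunc (d : int) (A1 A2 : point) w1 w2 : 0 < d ->
  A2 = (A1.1 + d, A1.2 - d) ->
  crossings (A1, rev w1) (A2, rev w2) = trunc_changes d w1 w2.
Proof.
move=> d0 A2E; rewrite (crossings_sum _ _ (ltW d0) A2E).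
have := @trunc_changes_prefix d (rev w1) (rev w2); rewrite !revK => ->.
apply/esym; apply: (@changes_sum (prefix_gap d (rev w1) (rev w2)) _
  (minn (size (rev w1)) (size (rev w2)))) => //.
- by rewrite /prefix_changes !take0.
- by move=> i; exact: prefix_changesS.
- by rewrite prefix_gap0 gt_eqF.
Qed.

Lemma crossings_trunc0 (A : point) w1 w2 :
  let X := crossings (A, rev w1) (A, rev w2) in
  [/\ trunc_changes 0 w1 w2 = 0, trunc_changes 0 w2 w1 = 0 & X = 0]%N \/
  exists b : bool, trunc_changes 0 w1 w2 = (X + b)%N /\
                   trunc_changes 0 w2 w1 = (X + ~~ b)%N.
Proof.
have AE : A = (A.1 + 0, A.2 - 0) by rewrite addr0 subr0; case: A.
rewrite /= (crossings_sum _ _ (lexx 0) AE).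
have := @trunc_changes_prefix 0 (rev w1) (rev w2); rewrite !revK => ->.
have := @trunc_changes_prefix 0 (rev w2) (rev w1); rewrite !revK minnC => ->.
apply: changes_sum_opp.
- by rewrite /prefix_changes !take0.
- by move=> i; exact: prefix_changesS.
- by rewrite /prefix_changes !take0.
- move=> i; rewrite minnC => /prefix_changesS ->; rewrite /flips.
  by rewrite -[in LHS]oppr0 /prefix_gap !gapC.
- by rewrite prefix_gap0.
Qed.

(** * The identities for each configuration of endpoints *)

(** Cutting back the longer path cannot undo a strict northwest order, so the last gap along the
    common length keeps its sign. *)
Lemma odd_trunc_changes d w1 w2 : 0 <= d ->
  let a := ecount w1 in let b := ecount w2 + d in
  let n1 := (size w1)%:Z in let n2 := (size w2)%:Z in
  (a < b -> n2 - b < n1 - a -> ~~ odd (trunc_changes d w1 w2)) /\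
  (b < a -> n1 - a < n2 - b -> odd (trunc_changes d w1 w2)).
Proof.
move=> d0 a b n1 n2; rewrite /trunc_changes.
set k1 := (size w1 - size w2)%N; set k2 := (size w2 - size w1)%N.
have sw : size (drop k1 w1) = size (drop k2 w2) by rewrite !size_drop /k1 /k2; lia.
have [gpos gneg] := odd_sign_changes d0 sw.
have /andP[h1 h2] := ecount_drop k1 w1; have /andP[h3 h4] := ecount_drop k2 w2.
move: gpos gneg; rewrite /gap => gpos gneg.
split=> ab n12; [apply: gpos|apply: gneg];
  by move: ab n12 h1 h2 h3 h4; rewrite /a /b /n1 /n2 /k1 /k2; clear; lia.
Qed.

Lemma ltn_parity r c : odd c = ~~ odd r -> (r < c)%N = (r <= c)%N.
Proof. by rewrite [(r <= c)%N]leq_eqVlt; case: (r =P c) => [->|//]; case: (odd c). Qed.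

Lemma f_pair_gf r (A1 A2 D1 D2 : point) : A1.1 + A1.2 = A2.1 + A2.2 ->
  pair_gf r (A2.1 - A1.1) (D1.1 + D1.2 - (A1.1 + A1.2)) (D1.1 - A1.1)
    (D2.1 + D2.2 - (A2.1 + A2.2)) (D2.1 - A1.1) =
  if odd r then f r%:Z A1 A2 D2 D1 else f r%:Z A1 A2 D1 D2.
Proof.
case: A1 A2 D1 D2 => [x1 y1] [x2 y2] [u1 v1] [u2 v2] /= h.
rewrite /pair_gf /f -!/(array_gf _ _ _).
have -> : r%:Z + (x2 - x1) = r%:Z + x2 - x1 by ring.
case: ifP => _; congr (_ *: (array_gf _ _ _ * array_gf _ _ _)); lia.
Qed.

Lemma Hge_neg r (A1 D1 A2 D2 : point) :
  (D1.1 + D1.2 < A1.1 + A1.2) || (D2.1 + D2.2 < A2.1 + A2.2) ->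
  Hge r A1 D1 A2 D2 = 0.
Proof.
move=> h; rewrite /Hge (_ : [set PQ | _] = set0) ?fsbig_set0//.
apply/seteqP; split=> // PQ /= [P1 P2 _].
by case/orP: h => h; [move: P1|move: P2]; rewrite (paths_empty h).
Qed.

Lemma Hge_pair_gf r (A1 D1 A2 D2 : point)
    (d := A2.1 - A1.1) (a := D1.1 - A1.1) (b := D2.1 - A1.1)
    (n1 := D1.1 + D1.2 - (A1.1 + A1.2)) (n2 := D2.1 + D2.2 - (A2.1 + A2.2)) :
  0 <= d -> end_order r n1 a n2 b ->
  (forall w1 w2, (size w1)%:Z = n1 -> (size w2)%:Z = n2 ->
     ecount w1 = a -> ecount w2 + d = b ->
     (r <= crossings (A1, rev w1) (A2, rev w2))%N = (r <= trunc_changes d w1 w2)%N) ->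
  Hge r A1 D1 A2 D2 = pair_gf r d n1 a n2 b.
Proof.
move=> d0; case: (ltrP n1 0) => [n1n _ _|].
  by rewrite Hge_neg ?pair_gf_neg ?n1n//; move: n1n; rewrite /n1; lia.
case: (ltrP n2 0) => [n2n _ _ _|].
  by rewrite Hge_neg ?pair_gf_neg ?n2n ?orbT//; move: n2n; rewrite /n2; lia.
case E2: n2 => [m2|//] _; case E1: n1 => [m1|//] _ ord H.
rewrite (Hge_wsum r E1 E2 erefl) -term_gfE//; apply: eq_wsum => w1 w2 s1 s2.
rewrite /term -/a -/d -/b; have [/eqP ea|//] := boolP (ecount w1 == a).
have [/eqP eb|//] := boolP (ecount w2 + d == b).
by rewrite H// ?s1 ?s2.
Qed.

Lemma eq_Hge r r' (A1 D1 A2 D2 : point) (d := A2.1 - A1.1) :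
  (forall w1 w2, (size w1)%:Z = D1.1 + D1.2 - (A1.1 + A1.2) ->
     (size w2)%:Z = D2.1 + D2.2 - (A2.1 + A2.2) ->
     ecount w1 = D1.1 - A1.1 -> ecount w2 + d = D2.1 - A1.1 ->
     (r <= crossings (A1, rev w1) (A2, rev w2))%N =
     (r' <= crossings (A1, rev w1) (A2, rev w2))%N) ->
  Hge r A1 D1 A2 D2 = Hge r' A1 D1 A2 D2.
Proof.
move=> H; set n1 := D1.1 + D1.2 - (A1.1 + A1.2); set n2 := D2.1 + D2.2 - (A2.1 + A2.2).
case: (ltrP n1 0) => [n1n|].
  by rewrite !Hge_neg//; move: n1n; rewrite /n1; lia.
case: (ltrP n2 0) => [n2n _|].
  by rewrite !Hge_neg//; move: n2n; rewrite /n2; lia.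
case E2: n2 => [m2|//] _; case E1: n1 => [m1|//] _.
rewrite !(Hge_wsum _ E1 E2 erefl); apply: eq_wsum => w1 w2 s1 s2.
have [/eqP ea|//] := boolP (ecount w1 == _).
have [/eqP eb|//] := boolP (ecount w2 + _ == _).
by rewrite H// ?s1 ?s2.
Qed.

Lemma wsumC phi n1 n2 : wsum phi n1 n2 = wsum (fun w2 w1 => phi w1 w2) n2 n1.
Proof. by rewrite /wsum exchange_big. Qed.

(** c is chi or chi + 1 (or both are 0), and the ends give c the parity opposite to r; hence r <= c
    and r <= chi agree. *)
Lemma Hge_common_start (A B1 B2 : point) r : northwest B1 B2 ->
  Hge r A B1 A B2 = f r%:Z A A B2 B1.
Proof.
move=> /andP[b1 b2].
have [ro|re] := boolP (odd r).
  rewrite Hge_pair_gf ?subrr//.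
  - by rewrite -[0](subrr A.1) f_pair_gf// ro.
  - by rewrite /end_order ro; lia.
  - move=> w1 w2 s1 s2 e1 e2.
    have [+ _] := odd_trunc_changes w1 w2 (lexx 0).
    rewrite s1 s2 e1 e2 => oc; have {}oc := oc ltac:(lia) ltac:(lia).
    have [[-> _ ->]//|[[] /= [Ec _]]] := crossings_trunc0 A w1 w2;
      last by rewrite Ec addn0.
    rewrite Ec addn1 in oc *; rewrite -[RHS]ltn_parity ?ltnS//.
    by rewrite (negbTE oc) ro.
(* For even r the path to B2 is taken first: it ends southeast, and its c is odd. *)
set n1 := B1.1 + B1.2 - (A.1 + A.2); set n2 := B2.1 + B2.2 - (A.1 + A.2).
have fE : f r%:Z A A B2 B1 = pair_gf r 0 n2 (B2.1 - A.1) n1 (B1.1 - A.1).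
  by rewrite -[0](subrr A.1) f_pair_gf// (negbTE re).
case: (ltrP n1 0) => [n1n|].
  by rewrite fE pair_gf_neg ?n1n ?orbT// Hge_neg//; move: n1n; rewrite /n1; lia.
case: (ltrP n2 0) => [n2n _|].
  by rewrite fE pair_gf_neg ?n2n// Hge_neg//; move: n2n; rewrite /n2; lia.
case E2: n2 => [m2|//] _; case E1: n1 => [m1|//] _.
rewrite fE E1 E2 -term_gfE//; last first.
  by rewrite -E1 -E2 /n1 /n2 /end_order (negbTE re); lia.
rewrite (Hge_wsum r E1 E2 erefl) /term_gf wsumC; apply: eq_wsum => w2 w1 s2 s1.
rewrite /term [weight w1 * _]mulrC subrr !addr0.
have [/eqP e1|_] := boolP (ecount w1 == B1.1 - A.1); last by rewrite andbF.
have [/eqP e2|//] := boolP (ecount w2 == B2.1 - A.1); rewrite /=.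
have [_ +] := odd_trunc_changes w2 w1 (lexx 0).
rewrite s1 s2 e1 e2 addr0 -E1 -E2 => oc.
have {}oc := oc ltac:(lia) ltac:(rewrite /n1 /n2; lia).
have [[_ E _]|[[] /= [_ Ec]]] := crossings_trunc0 A w1 w2.
- by move: oc; rewrite E.
- by rewrite Ec addn0.
rewrite Ec addn1 in oc *; rewrite -[(r <= _.+1)%N]ltn_parity ?ltnS//.
by rewrite oc (negbTE re).
Qed.

Section Diff.
Variables (A1 A2 B1 B2 : point).
Hypothesis hA : northwest A1 A2.
Hypothesis hdiag : A1.1 + A1.2 = A2.1 + A2.2.

Let d_gt0 : 0 < A2.1 - A1.1.
Proof. by move: hA; rewrite /northwest => /andP[? _]; lia. Qed.

Let A2E : A2 = (A1.1 + (A2.1 - A1.1), A1.2 - (A2.1 - A1.1)).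
Proof. by move: hdiag; case: A1 A2 => [? ?] [? ?] /= h; congr pair; lia. Qed.

Let crossE w1 w2 :
  crossings (A1, rev w1) (A2, rev w2) = trunc_changes (A2.1 - A1.1) w1 w2.
Proof. exact: crossings_trunc d_gt0 A2E. Qed.

Lemma Hge_common_end (B : point) r : Hge r A1 B A2 B = f r%:Z A1 A2 B B.
Proof.
rewrite Hge_pair_gf ?(ltW d_gt0)//.
- by rewrite f_pair_gf//; case: ifP.
- by rewrite /end_order; case: ifP; lia.
- by move=> w1 w2 *; rewrite crossE.
Qed.

Hypothesis hB : northwest B1 B2.

(** The path from A1 ends strictly southeast of the other, so the number of crossings is odd and
    never equals 2m. *)
Lemma Hge_even (m : nat) : Hge (2 * m + 1) A1 B2 A2 B1 = Hge (2 * m) A1 B2 A2 B1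
  /\ Hge (2 * m) A1 B2 A2 B1 = f (2 * m)%N%:Z A1 A2 B2 B1.
Proof.
have o : odd (2 * m) = false by rewrite oddM.
move: hB; rewrite /northwest => /andP[b1 b2]; split.
  apply: eq_Hge => w1 w2 s1 s2 e1 e2; rewrite crossE.
  have [_ /(_ _ _)] := odd_trunc_changes w1 w2 (ltW d_gt0).
  rewrite s1 s2 e1 e2 => oc; have {}oc := oc ltac:(lia) ltac:(lia).
  by rewrite addn1 ltn_parity// oc o.
rewrite Hge_pair_gf ?(ltW d_gt0)//.
- by rewrite f_pair_gf// o.
- by rewrite /end_order o; lia.
- by move=> w1 w2 *; rewrite crossE.
Qed.

Lemma Hge_odd (m : nat) : Hge (2 * m + 2) A1 B1 A2 B2 = Hge (2 * m + 1) A1 B1 A2 B2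
  /\ Hge (2 * m + 1) A1 B1 A2 B2 = f (2 * m + 1)%N%:Z A1 A2 B2 B1.
Proof.
have o : odd (2 * m + 1) by rewrite addn1 /= oddM.
move: hB; rewrite /northwest => /andP[b1 b2]; split.
  apply: eq_Hge => w1 w2 s1 s2 e1 e2; rewrite crossE.
  have [/(_ _ _) + _] := odd_trunc_changes w1 w2 (ltW d_gt0).
  rewrite s1 s2 e1 e2 => oc; have {}oc := oc ltac:(lia) ltac:(lia).
  by rewrite [(2 * m + 2)%N](addnS _ 1) ltn_parity// (negbTE oc) o.
rewrite Hge_pair_gf ?(ltW d_gt0)//.
- by rewrite f_pair_gf// o.
- by rewrite /end_order o; lia.
- by move=> w1 w2 *; rewrite crossE.
Qed.

End Diff.

(** * Both endpoints in common: the alternating sum *)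

Section Same.
Variables (A B : point).

Lemma Hge_same_succ (s : nat) : (0 < s)%N ->
  Hge s A B A B + Hge s.+1 A B A B = 2 * f s.+1%:Z A A B B.
Proof.
move=> s0; set n := B.1 + B.2 - (A.1 + A.2); set a := B.1 - A.1.
have fE : f s.+1%:Z A A B B = pair_gf s.+1 0 n a n a.
  by rewrite -[0](subrr A.1) f_pair_gf//; case: ifP.
case: (ltrP n 0) => [nn|].
  by rewrite fE pair_gf_neg ?nn// !Hge_neg ?addr0 ?mulr0//; move: nn; rewrite /n; lia.
case E: n => [m|//] _.
rewrite fE E -term_gfE//; last by rewrite /end_order; case: ifP; lia.
rewrite !(Hge_wsum _ E E erefl) -wsumD mulr_natl mulr2n.
(* The second copy is read with the paths exchanged, so each pair contributes through c(P, Q) and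
   c(Q, P). *)
rewrite [X in _ = _ + X]wsumC -wsumD; apply: eq_wsum => w1 w2 _ _.
rewrite /term -/a subrr !addr0 [weight w2 * _]mulrC.
have [/eqP e1|_] := boolP (ecount w1 == a); last by rewrite andbF.
have [/eqP e2|_] := boolP (ecount w2 == a); rewrite //= -!mulrnDr.
congr (_ *+ _); have [[-> -> ->]|[b [-> ->]]] := crossings_trunc0 A w1 w2.
  by rewrite leqn0 (gtn_eqF s0).
by case: b; rewrite /= addn1 addn0 !ltnS// addnC.
Qed.

Lemma Hge_same_large (s : nat) : (absz (B.1 + B.2 - (A.1 + A.2))%R < s)%N ->
  Hge s A B A B = 0.
Proof.
set n := _ - _; case: (ltrP n 0) => [nn _|].
  by rewrite Hge_neg//; move: nn; rewrite /n; lia.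
case E: n => [m|//] _ ms; rewrite (Hge_wsum _ E E erefl); apply: wsum0 => w1 w2 s1 _.
rewrite [(s <= _)%N]leqNgt (leq_ltn_trans (max_card _))//= ?andbF ?mulr0n//.
by rewrite card_ord /len /steps size_rev s1.
Qed.

Lemma Hge_same (r : nat) : (0 < r)%N -> Hge r A B A B =
  2 * \sum_(j \in [set j : nat | (1 <= j)%N]) (-1) ^+ (j - 1) * f (r + j)%N%:Z A A B B.
Proof.
(* [J] exceeds the path length, beyond which [Hge] vanishes, and the height, beyond which [f]
   does. *)
move=> r0; have [J [J1 J2]] : exists J : nat,
    (absz (B.1 + B.2 - (A.1 + A.2))%R < J)%N /\ (absz (B.2 - A.2)%R < J)%N.
  exists (absz (B.1 + B.2 - (A.1 + A.2))%R + absz (B.2 - A.2)%R)%N.+1.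
  by rewrite !ltnS leq_addr leq_addl.
rewrite (@fsbigE _ _ _ _ _ (iota 1 J)) ?iota_uniq//; last 2 first.
- by move=> j /=; rewrite mem_iota => /andP[].
- move=> j /= j1; rewrite mem_iota j1 /= -leqNgt => Jj.
  by rewrite f_eq0 ?mulr0//; lia.
have -> : \sum_(j <- iota 1 J | j \in [set j : nat | (1 <= j)%N])
    (-1) ^+ (j - 1) * f (r + j)%N%:Z A A B B =
  \sum_(i < J) (-1) ^+ i * f (r + i).+1%:Z A A B B.
  rewrite (iotaDl 1 0) big_map.
  rewrite -(big_mkord xpredT (fun i => (-1) ^+ i * f (r + i).+1%:Z A A B B)).
  rewrite /index_iota subn0; apply: eq_big => i; first by rewrite mem_setE.
  by rewrite add1n subn1 addnS.
(* Telescoping by [Hge_same_succ]; at K = J the remainder is zero. *)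
suff H K : 2 * \sum_(i < K) (-1) ^+ i * f (r + i).+1%:Z A A B B =
    Hge r A B A B - (-1) ^+ K * Hge (r + K) A B A B.
  by rewrite H (@Hge_same_large (r + J)) ?(leq_trans J1) ?leq_addl// mulr0 subr0.
elim: K => [|K IH]; first by rewrite big_ord0 mulr0 expr0 mul1r addn0 subrr.
rewrite big_ord_recr /= mulrDr IH mulrCA -Hge_same_succ ?addnS ?exprS; last by lia.
ring.
Qed.

End Same.

Theorem theorem2p2 (A1 A2 B1 B2 : point)
    (hA : northwest A1 A2) (hB : northwest B1 B2)
    (hdiag : A1.1 + A1.2 = A2.1 + A2.2) :
  (forall m : nat,
     (Hge (2 * m + 1) A1 B2 A2 B1 = Hge (2 * m) A1 B2 A2 B1
      /\ Hge (2 * m) A1 B2 A2 B1 = f (2 * m)%N%:Z A1 A2 B2 B1)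
     /\ (Hge (2 * m + 2) A1 B1 A2 B2 = Hge (2 * m + 1) A1 B1 A2 B2
         /\ Hge (2 * m + 1) A1 B1 A2 B2 = f (2 * m + 1)%N%:Z A1 A2 B2 B1))
  /\ (forall (A B : point) (r : nat),
     [/\ Hge r A B1 A B2 = f r%:Z A A B2 B1,
         Hge r A1 B A2 B = f r%:Z A1 A2 B B
       & Hge r A B A B =
         if r == 0%N then f 0 A A B B
         else 2 * \sum_(j \in [set j : nat | (1 <= j)%N])
                    (-1) ^+ (j - 1) * f (r + j)%N%:Z A A B B]).
Proof.
split=> [m|A B r]; first by split; [exact: Hge_even|exact: Hge_odd].
split; [exact: Hge_common_start|exact: Hge_common_end|].
case: r => [|r] /=; last exact: Hge_same.
rewrite Hge_pair_gf ?subrr//.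
- by rewrite -[0 in LHS](subrr A.1) f_pair_gf.
- by rewrite /end_order /= !lexx.
Qed.
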